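(* In the setting of the context, let $P$ be a patch in a tiling in $\Omega_{punc}$ and let $t,t'$ be tiles in $P$. Then both $e(P,t,t')$ and $z$ are in $C_c(R_{punc})$. Moreover: (i) $e(P,t,t')^\ast=e(P,t',t)$; (ii) $z\cdot e(P,t,t')=e^{(\angle t-\angle t')i}\,(e(P,t,t')\cdot z)$; (iii) if $P_1,P_2$ are patches in tilings in $\Omega_{punc}$, $t_1,t_1'\in P_1$, $t_2,t_2'\in P_2$, $t_1'=t_2$, and $P_1,P_2$ agree where they intersect, then $$e(P_1,t_1,t_1')\cdot e(P_2,t_2,t_2')=e(P_1\cup P_2,t_1,t_2');$$ (iv) under the hypotheses of (iii) and for $k,l\in\mathbb{Z}$, $$(z^k\cdot e(P_1,t_1,t_1'))\cdot(z^l\cdot e(P_2,t_2,t_2'))=e^{l(\angle t_2-\angle t_1)i}\,\big(z^{k+l}\cdot e(P_1\cup P_2,t_1,t_2')\big).$$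
   Context: **Tilings.** A tiling of $\mathbb{R}^2$ is a countable collection of closed polygonal subsets (tiles) covering $\mathbb{R}^2$ such that distinct tiles have disjoint interiors. A patch in a tiling is a finite subset of its tiles; $T\cap B(x,r)$ denotes the patch of tiles of $T$ completely contained in the open ball $B(x,r)$. $\Gamma=\mathbb{R}^2\rtimes \mathcal{S}^1$ is the group of orientation preserving isometries of $\mathbb{R}^2$, where $\mathcal{S}^1=SO(2,\mathbb{R})$ consists of the rotations $R_\theta$ about the origin; $(x,R_\theta)\in\Gamma$ acts on a tiling $T$ by $R_\theta(T+x)$. Put $d((x,R_\theta),(y,R_\phi))=|x-y|+\|R_\theta-R_\phi\|_{F}$ (Frobenius norm of the matrix difference). **Tiling metric.** For $0<\varepsilon<1$, say $T,T'$ are within $\varepsilon$ if there are $(x,R_\theta),(x',R_{\theta'})\in\Gamma$, each at $d$-distance $<\varepsilon$ from the identity, with $R_\theta(T+x)\cap B(0,\varepsilon^{-1})=R_{\theta'}(T'+x')\cap B(0,\varepsilon^{-1})$. Then $d_\Gamma(T,T')$ is the infimum of all such $\varepsilon$, or $1$ if there are none. The continuous hull $\Omega_T$ of a tiling $T$ is the completion of $\{T+x:x\in\mathbb{R}^2\}$ in $d_\Gamma$; its elements are tilings. **Standing assumptions.** There is a finite set of proto-tiles $\{p_1,\dots,p_n\}$ (closed polygons, pairwise not related by elements of $\Gamma$) such that each tile of each tiling in $\Omega_T$ is $\gamma(p_i)$ for some $\gamma\in\Gamma$ and some $i$. $\Gamma$ is the full group of orientation preserving isometries, in the sense that for every $\gamma\in\Gamma$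 and proto-tile $p$ some tiling in $\Omega_T$ contains $\gamma(p)$, and $\Omega_T$ is invariant under rotations. $\Omega_T$ has finite local complexity with respect to $\Gamma$: for every $r>0$ the set $\{T'\cap B(x,r):T'\in\Omega_T,\ x\in\mathbb{R}^2\}$ is finite modulo $\Gamma$. $\Omega_T$ is strongly aperiodic: $T'+x\ne T'$ for all $T'\in\Omega_T$ and $x\neq 0$. **Punctures.** Each proto-tile $p_i$ has a chosen point $x(p_i)$ in its interior (its puncture) such that the pointed polygon $(p_i,x(p_i))$ has trivial symmetry group; proto-tiles are placed in a fixed orientation with $x(p_i)=0$. Every tile $t=\gamma(p_i)$ gets the puncture $x(t)=\gamma(x(p_i))$. For a tile $t=R_\theta(p_i)+v$ put $\angle t=\theta$ (mod $2\pi$). The discrete hull is $\Omega_{punc}=\{T'\in\Omega_T : \text{some tile } t\in T' \text{ has } x(t)=0\}$ with metric $d_\Gamma$; for $T'\in\Omega_{punc}$, $T'(0)$ is the tile of $T'$ containing the origin. **Equivalence relation.** $R_{punc}=\{(T',T'-x(t)):T'\in\Omega_{punc},\ t\in T'\}$ has the topology of the metric $d_R((T_1,T_1-x(t_1)),(T_2,T_2-x(t_2)))=d_\Gamma(T_1,T_2)+|x(t_1)-x(t_2)|$; $[T']$ is the equivalence class of $T'$. $C_c(R_{punc})$ (continuous compactly supported complex functions) is a $\ast$-algebra with $f\cdot g(T_1,T_2)=\sum_{T_3\in[T_1]}f(T_1,T_3)g(T_3,T_2)$ and $f^\ast(T_1,T_2)=\overline{f(T_2,T_1)}$. **The functions.**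 For a finite set $P$ of tiles and $t,t'\in P$, $e(P,t,t')$ is the characteristic function of $$V(P,t,t')=\{(T_1,T_1-R_\theta(x(t')-x(t)))\in R_{punc} : R_\theta(P-x(t))\subset T_1 \text{ for some } R_\theta\in\mathcal{S}^1\}$$ (it is the zero function if no tiling in $\Omega_{punc}$ contains a rotated copy of $P-x(t)$). The function $z$ is $z(T_1,T_2)=e^{i\angle T_1(0)}$ if $T_1=T_2$ and $0$ otherwise; $z^k$ ($k\in\mathbb{Z}$) is its $k$-th power (as a unitary). Patches $P_1,P_2$ ''agree where they intersect'' if distinct tiles of $P_1\cup P_2$ have disjoint interiors.
   Formalization: It is additionally assumed that the puncture x(t)=γ(x(p_i)) depends only on the tile t as a subset of the plane, i.e. no proto-tile has a nontrivial rotational symmetry; otherwise x(t) and the angle of t are not well defined. *)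

(* Defs.v *)
From HB Require Import structures.
From mathcomp Require Import all_boot all_order all_algebra.
From mathcomp Require Import all_classical all_reals all_analysis.
From mathcomp Require Import complex.
Set Implicit Arguments.
Unset Strict Implicit.
Unset Printing Implicit Defensive.
Import Order.TTheory GRing.Theory Num.Theory.
Import numFieldNormedType.Exports.
Local Open Scope classical_set_scope.
Local Open Scope ring_scope.
Local Open Scope complex_scope.

Definition plane (R : realType) : Type := 'cV[R]_2.
HB.instance Definition _ (R : realType) := NormedModule.on (plane R).

(* Collections of subsets of the plane: tilings and patches are elements. *)
Definition tiles (R : realType) : Type := set (set (plane R)).
HB.instance Definition _ (R : realType) := Choice.on (tiles R).

(* Frobenius norm; for a column vector it is the Euclidean norm (the norm
   `|v| of the library is the sup norm). *)
Definition fnorm (R : realType) (m n : nat) (A : 'M[R]_(m, n)) : R :=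
  Num.sqrt (\sum_i \sum_j A i j ^+ 2).

Definition eball (R : realType) (x : plane R) (r : R) : set (plane R) :=
  [set y | fnorm (y - x) < r].

Definition rot (R : realType) (theta : R) : 'M[R]_2 :=
  \matrix_(i < 2, j < 2)
    if i == j then cos theta
    else if i == ord0 then - sin theta else sin theta.

(* The pair (x, theta) stands for the isometry (x, R_theta) of the plane; the
   angle theta is only ever used through the matrix [rot theta]. *)
Definition isom (R : realType) : Type := (plane R * R)%type.

Definition isom1 (R : realType) : isom R := (0, 0).

Definition isom_dist (R : realType) (g h : isom R) : R :=
  fnorm (g.1 - h.1) + fnorm (rot g.2 - rot h.2).

Definition isom_act_pt (R : realType) (g : isom R) (y : plane R) : plane R :=
  rot g.2 *m (y + g.1).

Definition isom_act_set (R : realType) (g : isom R) (A : set (plane R)) :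
    set (plane R) :=
  isom_act_pt g @` A.

Definition isom_act (R : realType) (g : isom R) (T : tiles R) : tiles R :=
  isom_act_set g @` T.

Definition translate_set (R : realType) (v : plane R) (A : set (plane R)) :
    set (plane R) :=
  [set y + v | y in A].

Definition translate (R : realType) (v : plane R) (T : tiles R) : tiles R :=
  translate_set v @` T.

Definition rot_set (R : realType) (theta : R) (A : set (plane R)) :
    set (plane R) :=
  [set rot theta *m y | y in A].

Definition rotate (R : realType) (theta : R) (T : tiles R) : tiles R :=
  rot_set theta @` T.

Definition triangle (R : realType) (a b c : plane R) : set (plane R) :=
  [set y | exists s t u : R, [/\ 0 <= s, 0 <= t, 0 <= u, s + t + u = 1 &
                                 y = s *: a + t *: b + u *: c]].

(* A closed polygonal set: a nonempty finite union of nondegenerate closed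
   triangles. *)
Definition polygon (R : realType) (A : set (plane R)) : Prop :=
  exists s : seq (plane R * plane R * plane R),
    [/\ s <> [::],
        (forall a b c, (a, b, c) \in s ->
           \det (row_mx (b - a) (c - a) : 'M[R]_2) != 0) &
        A = [set y | exists a b c, (a, b, c) \in s /\ triangle a b c y]].

Definition disjoint_interiors (R : realType) (T : tiles R) : Prop :=
  forall s t, T s -> T t -> s <> t -> s^° `&` t^° = set0.

Definition tiling (R : realType) (T : tiles R) : Prop :=
  [/\ countable T,
      (forall t, T t -> polygon t),
      \bigcup_(t in T) t = setT &
      disjoint_interiors T].

Definition patch_in_ball (R : realType) (T : tiles R) (x : plane R) (r : R) :
    tiles R :=
  [set t | T t /\ t `<=` eball x r].

Definition eps_close (R : realType) (T T' : tiles R) (e : R) : Prop :=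
  [/\ 0 < e, e < 1 &
      exists g g' : isom R,
        [/\ isom_dist g (isom1 R) < e,
            isom_dist g' (isom1 R) < e &
            patch_in_ball (isom_act g T) 0 e^-1 = patch_in_ball (isom_act g' T') 0 e^-1]].

Definition dGamma (R : realType) (T T' : tiles R) : R :=
  if `[< exists e, eps_close T T' e >] then inf [set e | eps_close T T' e] else 1.

(* The completion of the translation orbit of T, realized as its closure for
   dGamma among the tilings of the plane. *)
Definition hull (R : realType) (T : tiles R) : set (tiles R) :=
  [set T' | tiling T' /\
            forall e : R, 0 < e -> exists x, dGamma (translate x T) T' < e].

Record tiling_data (R : realType) := TilingData {
  base_tiling : tiles R;
  nproto : nat;
  proto : 'I_nproto -> set (plane R);
  proto_punc : 'I_nproto -> plane R }.

Definition Omega (R : realType) (D : tiling_data R) : set (tiles R) :=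
  hull (base_tiling D).

Definition isom_orbit (R : realType) (Q : tiles R) : set (tiles R) :=
  [set isom_act g Q | g in [set: isom R]].

Definition patches (R : realType) (D : tiling_data R) (r : R) : set (tiles R) :=
  [set Q | exists T' x, Omega D T' /\ Q = patch_in_ball T' x r].

Record standing (R : realType) (D : tiling_data R) : Prop := Standing {
  base_tilingP : tiling (base_tiling D);
  proto_polygon : forall i : 'I_(nproto D), polygon (proto i);
  proto_unrelated : forall (i j : 'I_(nproto D)) (g : isom R),
    i <> j -> isom_act_set g (proto i) <> proto j;
  tiles_proto : forall T' t, Omega D T' -> T' t ->
    exists (g : isom R) (i : 'I_(nproto D)), t = isom_act_set g (proto i);
  full_group : forall (g : isom R) (i : 'I_(nproto D)),
    exists2 T', Omega D T' & T' (isom_act_set g (proto i));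
  rot_invariant : forall T' theta, Omega D T' -> Omega D (rotate theta T');
  FLC : forall r : R, 0 < r ->
    finite_set [set isom_orbit Q | Q in patches D r];
  aperiodic : forall T' x, Omega D T' -> x <> 0 -> translate x T' <> T';
  proto_punc_interior : forall i : 'I_(nproto D),
    (proto i)^° (proto_punc i);
  proto_punc0 : forall i : 'I_(nproto D), proto_punc i = 0;
  proto_pointed_asym : forall (i : 'I_(nproto D)) (g : isom R),
    isom_act_set g (proto i) = proto i -> isom_act_pt g (proto_punc i) = proto_punc i ->
    g.1 = 0 /\ rot g.2 = 1%:M;
  (* the rule x(g(p_i)) = g(x(p_i)) assigns one puncture to each tile *)
  punc_well_defined : forall (i : 'I_(nproto D)) (g h : isom R),
    isom_act_set g (proto i) = isom_act_set h (proto i) ->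
    isom_act_pt g (proto_punc i) = isom_act_pt h (proto_punc i) }.

Section Punctured.
Variables (R : realType) (D : tiling_data R).

Definition punc (t : set (plane R)) : plane R :=
  xget 0 [set y | exists (g : isom R) (i : 'I_(nproto D)),
                    t = isom_act_set g (proto i) /\ y = isom_act_pt g (proto_punc i)].

(* The angle of a tile modulo 2 pi, as its representative in [0, 2 pi[. *)
Definition tile_angle (t : set (plane R)) : R :=
  xget 0 [set theta | 0 <= theta < 2 * pi /\
            exists (i : 'I_(nproto D)) (v : plane R),
              t = translate_set v (rot_set theta (proto i))].

Definition Omega_punc : set (tiles R) :=
  [set T' | Omega D T' /\ exists2 t, T' t & punc t = 0].

Definition tile0 (T' : tiles R) : set (plane R) :=
  xget set0 [set t | T' t /\ t 0].

Definition Rpunc_set : set (tiles R * tiles R) :=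
  [set p | exists T' t,
     [/\ Omega_punc T', T' t & p = (T', translate (- punc t) T')]].

Definition Rpunc : Type := {p : tiles R * tiles R | p \in Rpunc_set}.

HB.instance Definition _ := SubChoice.on Rpunc.

Definition src (p : Rpunc) : tiles R := (val p).1.
Definition tgt (p : Rpunc) : tiles R := (val p).2.

(* The vector x(t) of an element (T', T' - x(t)); it is determined by the pair
   because T' has no periods. *)
Definition Rvec (p : Rpunc) : plane R :=
  xget 0 [set y | exists t, [/\ src p t, y = punc t & tgt p = translate (- y) (src p)]].

Definition dR (p q : Rpunc) : R :=
  dGamma (src p) (src q) + fnorm (Rvec p - Rvec q).

Definition dR_open : set_system Rpunc :=
  [set U | forall p, U p ->
     exists2 e : R, 0 < e & forall q, dR p q < e -> U q].

Lemma dR_openT : dR_open setT.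
Proof. by move=> p _; exists 1. Qed.

Lemma dR_openI : setI_closed dR_open.
Proof.
move=> U V oU oV p [/oU[e e0 He] /oV[d d0 Hd]].
exists (Num.min e d); first by rewrite lt_min e0.
by move=> q; rewrite lt_min => /andP[/He Uq /Hd Vq].
Qed.

Lemma dR_open_bigU (I : Type) (f : I -> set Rpunc) :
  (forall i, dR_open (f i)) -> dR_open (\bigcup_i f i).
Proof.
move=> of_ p [i _ /(of_ i)[e e0 He]].
by exists e => // q /He fq; exists i.
Qed.

HB.instance Definition _ :=
  isOpenTopological.Build Rpunc dR_openT dR_openI dR_open_bigU.

Definition Cc (f : Rpunc -> R[i]) : Prop :=
  continuous (f : Rpunc -> (R[i] : numFieldType)) /\
  compact (closure [set p | f p != 0]).

Definition Rclass (T' : tiles R) : set (tiles R) :=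
  [set T'' | Rpunc_set (T', T'')].

Definition Rvalue (f : Rpunc -> R[i]) (T1 T2 : tiles R) : R[i] :=
  if insub (T1, T2) is Some p then f p else 0.

Definition convolution (f g : Rpunc -> R[i]) (p : Rpunc) : R[i] :=
  \sum_(T3 \in Rclass (src p)) Rvalue f (src p) T3 * Rvalue g T3 (tgt p).

Definition involution (f : Rpunc -> R[i]) (p : Rpunc) : R[i] :=
  (Rvalue f (tgt p) (src p))^*.

Definition diag_fun : Rpunc -> R[i] := \1_[set p | src p = tgt p].

(* Powers of a unitary: negative powers are powers of its adjoint. *)
Definition upow (f : Rpunc -> R[i]) (k : int) : Rpunc -> R[i] :=
  match k with
  | Posz n => iter n (convolution f) diag_fun
  | Negz n => iter n.+1 (convolution (involution f)) diag_fun
  end.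

Definition Vset (P : tiles R) (t t' : set (plane R)) : set Rpunc :=
  [set p | exists theta : R,
     rotate theta (translate (- punc t) P) `<=` src p /\
     tgt p = translate (- (rot theta *m (punc t' - punc t))) (src p)].

Definition efun (P : tiles R) (t t' : set (plane R)) : Rpunc -> R[i] :=
  \1_(Vset P t t').

Definition expi (theta : R) : R[i] := cos theta +i* sin theta.

Definition zfun (p : Rpunc) : R[i] :=
  if src p == tgt p then expi (tile_angle (tile0 (src p))) else 0.

Definition is_patch (P : tiles R) : Prop :=
  finite_set P /\ exists2 T', Omega_punc T' & P `<=` T'.

End Punctured.
Arguments Cc {R D}.
Arguments convolution {R D}.
Arguments involution {R D}.
Arguments upow {R D}.
Arguments punc {R} D.
Arguments tile_angle {R} D.
Arguments efun {R} D.
Arguments zfun {R} D.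
Arguments expi {R}.

Definition agree (R : realType) (P1 P2 : tiles R) : Prop :=
  disjoint_interiors (P1 `|` P2).

(* Main.v *)
(** If two punctured tilings are close for [dGamma], a tile of the first with
    puncture 0 is moved by a small isometry onto a tile of the second whose
    puncture is close to 0. Punctures are uniformly discrete, so that puncture is
    0 and the isometry is a rotation: near the origin the two tilings differ by a
    small rotation. Hence the sets [Vset P t t'] and the diagonal are uniformly
    clopen, and [zfun] is continuous.

    Compact supports: rotate every tiling so that its tile at the origin is a
    proto-tile. By finite local complexity the rotated tilings have finitely many
    patches in each ball, so an ultrafilter picks one patch for each radius; these
    glue to a tiling of the hull, and the angles converge in a compact interval.
    This gives a limit of the ultrafilter on every set of bounded [Rvec]. No
    triangle inequality for [dGamma] is involved.

    The identities hold because a pair in [Vset P t t'] determines the rotation of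
    [P]: the tile at the origin of the first tiling is the rotated [t], and pointed
    proto-tiles have no symmetry. So every convolution has at most one nonzero
    term. *)

Require Import Defs.
From mathcomp Require Import all_boot all_order all_algebra.
From mathcomp Require Import all_classical all_reals all_analysis.
From mathcomp Require Import complex.
From mathcomp Require Import ring lra.
(* [seq.rot] would otherwise shadow the rotation matrix [rot]. *)
Import Defs.
Set Implicit Arguments.
Unset Strict Implicit.
Unset Printing Implicit Defensive.
Import Order.TTheory GRing.Theory Num.Theory.
Import numFieldNormedType.Exports.
Local Open Scope classical_set_scope.
Local Open Scope ring_scope.

(** * Plane geometry and rigid motions *)

Section Plane.
Variable R : realType.
Implicit Types (u v w x y : plane R) (a b th : R).

Local Notation o0 := (ord0 : 'I_2).
Local Notation o1 := (ord_max : 'I_2).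
Local Notation xx v := ((v : 'cV[R]_2) o0 ord0).
Local Notation yy v := ((v : 'cV[R]_2) o1 ord0).

Lemma planeP v w : xx v = xx w -> yy v = yy w -> v = w.
Proof.
move=> h0 h1; apply/matrixP => i j; rewrite (ord1 j).
case: i => -[|[|//]] Hi; [rewrite (_ : Ordinal Hi = o0)//|rewrite (_ : Ordinal Hi = o1)//]; exact: val_inj.
Qed.

Lemma rot_x a v : xx (rot a *m v) = cos a * xx v - sin a * yy v.
Proof. by rewrite !mxE big_ord_recr big_ord1 /= !mxE/= !mulNr; congr (_ * v _ _ - _ ); apply val_inj. Qed.

Lemma rot_y a v : yy (rot a *m v) = sin a * xx v + cos a * yy v.
Proof. by rewrite !mxE big_ord_recr big_ord1 /= !mxE/=; congr (_ * v _ _ + _); apply val_inj. Qed.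

Lemma add_c v w (i : 'I_2) : (v + w : 'cV[R]_2) i ord0 = (v : 'cV[R]_2) i ord0 + (w : 'cV[R]_2) i ord0.
Proof. by rewrite mxE. Qed.
Lemma opp_c v (i : 'I_2) : (- v : 'cV[R]_2) i ord0 = - (v : 'cV[R]_2) i ord0.
Proof. by rewrite mxE. Qed.
Lemma zero_c (i : 'I_2) : (0 : plane R) i ord0 = 0 :> R.
Proof. by rewrite mxE. Qed.
Lemma scale_c a v (i : 'I_2) : (a *: v : plane R) i ord0 = a * (v : 'cV[R]_2) i ord0.
Proof. by rewrite mxE. Qed.

Definition coordE := (rot_x, rot_y, add_c, opp_c, zero_c, scale_c).

Lemma fnormE v : fnorm v = Num.sqrt (xx v ^+ 2 + yy v ^+ 2).
Proof.
rewrite /fnorm big_ord_recr !big_ord1/=; congr (Num.sqrt (v _ _ ^+ 2 + _)); exact: val_inj.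
Qed.

Lemma fnorm_rotBE a b : fnorm (rot a - rot b) =
  Num.sqrt (2 * ((cos a - cos b) ^+ 2 + (sin a - sin b) ^+ 2)).
Proof.
rewrite /fnorm !big_ord_recr !big_ord0/= !mxE/=; congr Num.sqrt; ring.
Qed.


Lemma rot_angleD a b : rot (a + b) = rot a *m rot b.
Proof.
apply/matrixP => i j; rewrite !mxE big_ord_recr big_ord1 /= !mxE cosD sinD /=.
case: i => -[|[|//]] Hi; case: j => -[|[|//]] Hj; rewrite /eq_op /=; ring.
Qed.

Lemma rot_angle0 : rot 0 = 1%:M :> 'M[R]_2.
Proof.
apply/matrixP => i j; rewrite !mxE cos0 sin0 oppr0.
by case: (i == j); case: (i == _).
Qed.

Lemma rot0m v : rot 0 *m v = v. Proof. by rewrite rot_angle0 mul1mx. Qed.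

Lemma rotDm a b v : rot a *m (rot b *m v) = rot (a + b) *m v.
Proof. by rewrite rot_angleD mulmxA. Qed.

Lemma rotKm a v : rot (- a) *m (rot a *m v) = v.
Proof. by rewrite rotDm addNr rot0m. Qed.

Lemma rotNKm a v : rot a *m (rot (- a) *m v) = v.
Proof. by rewrite rotDm addrN rot0m. Qed.

Lemma rot_mx0 a : rot a *m (0 : plane R) = 0.
Proof. exact: mulmx0. Qed.

Lemma rot_cos_sin a b : rot a = rot b <-> cos a = cos b /\ sin a = sin b.
Proof.
split=> [e|[ec es]]; last by apply/matrixP => i j; rewrite !mxE ec es.
have /matrixP/(_ ord0 ord0) := e; have /matrixP/(_ o1 ord0) := e.
by rewrite !mxE /=.
Qed.

Lemma rot_eqD a b c : rot a = rot b -> rot (c + a) = rot (c + b).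
Proof. by move=> e; rewrite !rot_angleD e. Qed.

(** Minkowski's inequality, kept in scalar form because it serves both plane vectors and the pairs
    of cosine and sine that determine a rotation. *)
Lemma hypot_triangle (p q r s : R) :
  Num.sqrt ((p + r) ^+ 2 + (q + s) ^+ 2) <=
  Num.sqrt (p ^+ 2 + q ^+ 2) + Num.sqrt (r ^+ 2 + s ^+ 2).
Proof.
have h1 : 0 <= p ^+ 2 + q ^+ 2 by rewrite addr_ge0 ?sqr_ge0.
have h2 : 0 <= r ^+ 2 + s ^+ 2 by rewrite addr_ge0 ?sqr_ge0.
have A0 := sqrtr_ge0 (p ^+ 2 + q ^+ 2); have B0 := sqrtr_ge0 (r ^+ 2 + s ^+ 2).
have A2 := sqr_sqrtr h1; have B2 := sqr_sqrtr h2.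
set A := Num.sqrt (p ^+ 2 + _) in A0 A2 *; set B := Num.sqrt (r ^+ 2 + _) in B0 B2 *.
have AB : p * r + q * s <= A * B.
  apply: le_trans (ler_norm _) _.
  rewrite -(@ler_pXn2r _ 2) ?nnegrE ?mulr_ge0 // real_normK ?num_real // exprMn A2 B2.
  rewrite -subr_ge0.
  (* Lagrange's identity, whence Cauchy-Schwarz. *)
  have -> : (p ^+ 2 + q ^+ 2) * (r ^+ 2 + s ^+ 2) - (p * r + q * s) ^+ 2
    = (p * s - q * r) ^+ 2 by ring.
  exact: sqr_ge0.
rewrite -(@ler_pXn2r _ 2) ?nnegrE ?addr_ge0 ?sqrtr_ge0 // sqr_sqrtr ?addr_ge0 ?sqr_ge0 //.
rewrite [X in _ <= X]sqrrD A2 B2; lra.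
Qed.

Lemma fnorm_ge0 v : 0 <= fnorm v. Proof. exact: sqrtr_ge0. Qed.

Lemma fnorm_triangle v w : fnorm (v + w) <= fnorm v + fnorm w.
Proof. by rewrite !fnormE !coordE; exact: hypot_triangle. Qed.

Lemma fnorm0 : fnorm (0 : plane R) = 0.
Proof. by rewrite fnormE !coordE expr0n addr0 sqrtr0. Qed.

Lemma fnormN v : fnorm (- v) = fnorm v.
Proof. by rewrite !fnormE !coordE !sqrrN. Qed.

Lemma fnormBC v w : fnorm (v - w) = fnorm (w - v).
Proof. by rewrite -fnormN opprB. Qed.

Lemma fnorm_rot a v : fnorm (rot a *m v) = fnorm v.
Proof.
rewrite !fnormE !coordE; congr Num.sqrt.
have := cos2Dsin2 a; set c := cos a; set s := sin a => h.
transitivity ((c ^+ 2 + s ^+ 2) * (xx v ^+ 2 + yy v ^+ 2)); first ring.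
by rewrite h mul1r.
Qed.

Lemma fnormZ a v : fnorm (a *: v) = `|a| * fnorm v.
Proof. by rewrite !fnormE !coordE !exprMn -mulrDr sqrtrM ?sqr_ge0// sqrtr_sqr. Qed.

Lemma fnorm_coord v (i : 'I_2) : `|(v : 'cV[R]_2) i ord0| <= fnorm v.
Proof.
rewrite -sqrtr_sqr /fnorm ler_wsqrtr // big_ord_recr !big_ord1 /=.
case: i => -[|[|//]] Hi.
  rewrite (_ : widen_ord _ _ = Ordinal Hi); last exact: val_inj.
  by rewrite lerDl sqr_ge0.
rewrite (_ : o1 = Ordinal Hi); last exact: val_inj.
by rewrite lerDr sqr_ge0.
Qed.

Lemma fnorm_le_coord v : fnorm v <= `|xx v| + `|yy v|.
Proof.
rewrite fnormE.
have := hypot_triangle (xx v) 0 0 (yy v).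
by rewrite !(expr0n, addr0, add0r) /= !sqrtr_sqr.
Qed.

(** A difference of rotations scales all lengths by one factor, and the Frobenius norm counts both
    columns: squared, the right side is twice the left. *)
Lemma fnorm_rotB a b v :
  fnorm (rot a *m v - rot b *m v) <= fnorm (rot a - rot b) * fnorm v.
Proof.
rewrite fnorm_rotBE !fnormE !coordE -sqrtrM; last first.
  by rewrite mulr_ge0// addr_ge0 ?sqr_ge0.
apply: ler_wsqrtr; rewrite -subr_ge0.
rewrite [X in 0 <= X](_ : _ = ((cos a - cos b) ^+ 2 + (sin a - sin b) ^+ 2) *
   (xx v ^+ 2 + yy v ^+ 2)); last ring.
by rewrite mulr_ge0// addr_ge0 ?sqr_ge0.
Qed.

(** Multiplication by the rotation of angle [- b] preserves the Frobenius norm. *)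
Lemma fnorm_rotB1 a b : fnorm (rot (a - b) - rot 0) = fnorm (rot a - rot b).
Proof.
rewrite !fnorm_rotBE cosB sinB cos0 sin0; congr (Num.sqrt (_ * _)).
have := cos2Dsin2 a; have := cos2Dsin2 b.
move: (cos a) (sin a) (cos b) (sin b) => ca sa cb sb hb ha.
transitivity ((ca ^+ 2 + sa ^+ 2) * (cb ^+ 2 + sb ^+ 2) + 1 - 2 * (ca * cb + sa * sb)).
  ring.
rewrite ha hb.
transitivity ((ca ^+ 2 + sa ^+ 2) + (cb ^+ 2 + sb ^+ 2) - 2 * (ca * cb + sa * sb)).
  by rewrite ha hb; ring.
ring.
Qed.

Lemma fnorm_rotBC a b : fnorm (rot a - rot b) = fnorm (rot b - rot a).
Proof. by rewrite !fnorm_rotBE; congr Num.sqrt; ring. Qed.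

Lemma fnorm_rot_triangle a b c :
  fnorm (rot a - rot c) <= fnorm (rot a - rot b) + fnorm (rot b - rot c).
Proof.
rewrite !fnorm_rotBE !sqrtrM// -mulrDr ler_wpM2l ?sqrtr_ge0 //.
have := hypot_triangle (cos a - cos b) (sin a - sin b) (cos b - cos c) (sin b - sin c).
by rewrite !addrA !subrK.
Qed.

(** * Euclidean balls and the topology of the plane *)

Lemma eballE x r y : eball x r y = (fnorm (y - x) < r) :> Prop. Proof. by []. Qed.

Lemma nbhs_eball x (e : R) : 0 < e -> nbhs x (eball x e).
Proof.
(* The topology comes from the sup norm; two coordinates below [e / 2] keep the Euclidean norm below
   [e]. *)
move=> e0; apply/nbhs_ballP; exists (e / 2); first by rewrite /= divr_gt0.
move=> y [_ xy]; rewrite eballE.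
have h i : `|((y - x : plane R) : 'cV[R]_2) i ord0| < e / 2.
  by rewrite !coordE distrC; exact: xy.
apply: le_lt_trans (fnorm_le_coord _) _.
by rewrite [ltRHS](splitr e) ltrD.
Qed.

Lemma eball_nbhs x (A : set (plane R)) : nbhs x A ->
  exists2 e : R, 0 < e & eball x e `<=` A.
Proof.
move=> /nbhs_ballP[e /= e0 xA]; exists e => // y xy; apply: xA; split => // i j.
rewrite (ord1 j) /ball /= distrC.
have := fnorm_coord (y - x : plane R) i; rewrite !coordE => h.
exact: le_lt_trans h xy.
Qed.

Lemma interior_eballP (A : set (plane R)) x :
  A^° x <-> exists2 e : R, 0 < e & eball x e `<=` A.
Proof.
split; first exact: eball_nbhs.
move=> [e e0 eA]; apply: filterS eA _; exact: nbhs_eball.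
Qed.

Lemma sub_eball x y (r s : R) : fnorm (x - y) + r <= s -> eball x r `<=` eball y s.
Proof.
move=> h z; rewrite !eballE => xz; rewrite -(subrK x z) -addrA.
apply: le_lt_trans (fnorm_triangle _ _) _; lra.
Qed.

(** Normal form of an isometry, rotating before translating, whereas [isom_act_pt] translates first.
    In this order [v] is the image of the origin, hence the puncture of a moved proto-tile. *)
Definition move a v y : plane R := rot a *m y + v.
Definition mvset a v (A : set (plane R)) : set (plane R) := move a v @` A.
Definition mvtil a v (T : tiles R) : tiles R := mvset a v @` T.

Lemma move_comp a b v w y : move a v (move b w y) = move (a + b) (rot a *m w + v) y.
Proof. by rewrite /move mulmxDr rotDm addrA. Qed.

Lemma move0 y : move 0 0 y = y. Proof. by rewrite /move rot0m addr0. Qed.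

Lemma mvset_comp a b v w A : mvset a v (mvset b w A) = mvset (a + b) (rot a *m w + v) A.
Proof. by rewrite /mvset image_comp; apply: eq_imagel => y _; exact: move_comp. Qed.

Lemma mvtil_comp a b v w T : mvtil a v (mvtil b w T) = mvtil (a + b) (rot a *m w + v) T.
Proof. by rewrite /mvtil image_comp; apply: eq_imagel => y _; exact: mvset_comp. Qed.

Lemma mvset0 A : mvset 0 0 A = A.
Proof.
by rewrite /mvset; apply/seteqP; split => [_ [y Ay <-]|y Ay]; [|exists y => //]; rewrite move0.
Qed.

Lemma mvtil0 T : mvtil 0 0 T = T.
Proof.
by rewrite /mvtil; apply/seteqP; split => [_ [y Ay <-]|y Ay]; [|exists y => //]; rewrite mvset0.
Qed.

Lemma mvset_rot a b v A : rot a = rot b -> mvset a v A = mvset b v A.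
Proof. by move=> e; rewrite /mvset /move e. Qed.

Lemma mvtil_rot a b v T : rot a = rot b -> mvtil a v T = mvtil b v T.
Proof. by move=> e; rewrite /mvtil /mvset /move e. Qed.

Lemma mvsetK a v A : mvset (- a) (- (rot (- a) *m v)) (mvset a v A) = A.
Proof. by rewrite mvset_comp addNr addrN mvset0. Qed.

Lemma isom_act_ptE (g : isom R) y : isom_act_pt g y = move g.2 (rot g.2 *m g.1) y.
Proof. by rewrite /isom_act_pt mulmxDr. Qed.

Lemma isom_act_setE (g : isom R) A : isom_act_set g A = mvset g.2 (rot g.2 *m g.1) A.
Proof. by apply: eq_imagel => y _; exact: isom_act_ptE. Qed.

Lemma isom_actE (g : isom R) T : isom_act g T = mvtil g.2 (rot g.2 *m g.1) T.
Proof. by apply: eq_imagel => y _; exact: isom_act_setE. Qed.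

Lemma translate_setE v A : translate_set v A = mvset 0 v A.
Proof. by apply: eq_imagel => y _; rewrite /move rot0m. Qed.

Lemma translateE v T : translate v T = mvtil 0 v T.
Proof. by apply: eq_imagel => y _; exact: translate_setE. Qed.

Lemma rot_setE a A : rot_set a A = mvset a 0 A.
Proof. by apply: eq_imagel => y _; rewrite /move addr0. Qed.

Lemma rotateE a T : rotate a T = mvtil a 0 T.
Proof. by apply: eq_imagel => y _; exact: rot_setE. Qed.

Lemma mvset_sub a v A B : A `<=` B -> mvset a v A `<=` mvset a v B.
Proof. exact: image_subset. Qed.

Lemma mvtil_sub a v T T' : T `<=` T' -> mvtil a v T `<=` mvtil a v T'.
Proof. exact: image_subset. Qed.

Lemma mvtil_in a v T t : T t -> mvtil a v T (mvset a v t).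
Proof. by move=> Tt; exists t. Qed.

Lemma mvset_eball a v x r : mvset a v (eball x r) = eball (move a v x) r.
Proof.
have h b w z s : mvset b w (eball z s) `<=` eball (move b w z) s.
  move=> _ [y yz <-]; rewrite eballE /move.
  rewrite [X in fnorm X](_ : _ = rot b *m (y - z)) ?fnorm_rot //.
  by rewrite mulmxBr opprD addrACA subrr addr0.
apply/seteqP; split; first exact: h.
move=> y yx; exists (move (- a) (- (rot (- a) *m v)) y).
  have := h (- a) (- (rot (- a) *m v)) (move a v x) r (move (- a) (- (rot (- a) *m v)) y).
  by rewrite move_comp addNr addrN move0; apply; exists y.
by rewrite move_comp addrN mulmxN rotNKm addNr move0.
Qed.

Lemma mvset_interior a v A : (mvset a v A)^° = mvset a v A^°.
Proof.
have h b w B : mvset b w B^° `<=` (mvset b w B)^°.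
  move=> _ [y /interior_eballP[e e0 eB] <-]; apply/interior_eballP; exists e => //.
  by rewrite -mvset_eball; exact: mvset_sub.
apply/seteqP; split; last exact: h.
move=> y yA; have := h (- a) (- (rot (- a) *m v)) (mvset a v A).
rewrite mvsetK => /(@mvset_sub a v); rewrite mvset_comp addrN mulmxN rotNKm addNr mvset0.
by apply.
Qed.

(** A tile that the motion brings into the ball of radius [s] was in the ball of radius
    [fnorm v + s] before, where the two tilings agree. *)
Lemma patch_move a v (T T' : tiles R) (r s : R) : fnorm v + s <= r ->
  patch_in_ball T 0 r = patch_in_ball T' 0 r ->
  patch_in_ball (mvtil a v T) 0 s = patch_in_ball (mvtil a v T') 0 s.
Proof.
move=> vr; have sub : forall S S' : tiles R, patch_in_ball S 0 r = patch_in_ball S' 0 r ->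
    patch_in_ball (mvtil a v S) 0 s `<=` patch_in_ball (mvtil a v S') 0 s.
  move=> S S' SS' _ [[t St <-] ts]; split => //; apply: mvtil_in.
  have : patch_in_ball S 0 r t.
    split=> // y ty; rewrite eballE subr0 -(fnorm_rot a).
    have := ts (move a v y); rewrite eballE subr0 => /(_ (imageP _ ty)) h.
    rewrite -(addrK v (_ *m _)); apply: le_lt_trans (fnorm_triangle _ _) _.
    by rewrite fnormN; apply: lt_le_trans vr; rewrite [ltRHS]addrC ltrD2r.
  by rewrite SS' => -[].
by move=> TT'; apply/seteqP; split; apply: sub.
Qed.

Lemma patch_sub (T T' : tiles R) (r s : R) : s <= r ->
  patch_in_ball T 0 r = patch_in_ball T' 0 r ->
  patch_in_ball T 0 s = patch_in_ball T' 0 s.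
Proof.
move=> sr /(@patch_move 0 0 _ _ r s); rewrite !mvtil0; apply.
by rewrite fnorm0 add0r.
Qed.

End Plane.

(** * Polygons *)

Section Polygons.
Variable R : realType.
Implicit Types (u v w x y : plane R) (A : set (plane R)).

Local Notation o0 := (ord0 : 'I_2).
Local Notation o1 := (ord_max : 'I_2).
Local Notation xx v := ((v : 'cV[R]_2) o0 ord0).
Local Notation yy v := ((v : 'cV[R]_2) o1 ord0).

Lemma det_mx22 (M : 'M[R]_2) : \det M = M o0 o0 * M o1 o1 - M o0 o1 * M o1 o0.
Proof.
rewrite (expand_det_row M ord0) big_ord_recr big_ord1 /= /cofactor !det_mx11 !mxE /=.
rewrite expr0 expr1 mul1r mulN1r mulrN.
by congr (M _ _ * M _ _ - M _ _ * M _ _); apply: val_inj.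
Qed.

Lemma det_row2 u v : \det (row_mx u v : 'M[R]_2) = xx u * yy v - xx v * yy u.
Proof.
rewrite det_mx22.
have El i : (row_mx u v : 'M[R]_2) i o0 = u i ord0.
  by rewrite -(row_mxEl u v i ord0); congr (row_mx u v _ _); exact: val_inj.
have Er i : (row_mx u v : 'M[R]_2) i o1 = v i ord0.
  by rewrite -(row_mxEr u v i ord0); congr (row_mx u v _ _); exact: val_inj.
by rewrite !El !Er.
Qed.

Lemma triangle_bounded (a b c : plane R) : 
  triangle a b c `<=` eball 0 (fnorm a + fnorm b + fnorm c + 1).
Proof.
move=> y [s [t [u [s0 t0 u0 stu ->]]]]; rewrite eballE subr0.
have h (r : R) w : 0 <= r -> r <= 1 -> fnorm (r *: w) <= fnorm w.
  by move=> r0 r1; rewrite fnormZ ger0_norm // ler_piMl ?fnorm_ge0.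
have h1 := fnorm_triangle (s *: a + t *: b) (u *: c).
have h2 := fnorm_triangle (s *: a) (t *: b).
have := h s a s0; have := h t b t0; have := h u c u0.
lra.
Qed.

Lemma polygon_bounded A : polygon A -> exists M, A `<=` eball 0 M.
Proof.
move=> [s [_ _ ->]].
suff [M HM] : exists M, forall a b c, (a, b, c) \in s -> triangle a b c `<=` eball 0 M.
  by exists M => y [a [b [c [abc]]]]; exact: HM.
elim: s => [|[[a b] c] s [M HM]]; first by exists 0.
exists (Num.max M (fnorm a + fnorm b + fnorm c + 1)) => a' b' c'.
rewrite inE => /orP[/eqP[-> -> ->]|/HM h] y.
  by move/triangle_bounded; rewrite !eballE lt_max => ->; rewrite orbT.
by move/h; rewrite !eballE lt_max => ->.
Qed.

Lemma triangle_translate (a b c v : plane R) :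
  mvset 0 v (triangle a b c) `<=` triangle (a + v) (b + v) (c + v).
Proof.
move=> _ [y [s [t [u [s0 t0 u0 stu ->]]]] <-]; exists s, t, u; split => //.
rewrite /move rot0m -[in LHS](scale1r v) -stu.
by apply: planeP; rewrite !coordE; ring.
Qed.

Lemma polygon_translate v A : polygon A -> polygon (mvset 0 v A).
Proof.
move=> [s [s0 sd ->]].
exists [seq (abc.1.1 + v, abc.1.2 + v, abc.2 + v) | abc <- s]; split.
- by case: s s0 {sd}.
- move=> a b c /mapP[[[a' b'] c'] /= abc [-> -> ->]].
  by have := sd _ _ _ abc; rewrite !opprD !(addrACA _ v) !subrr !addr0.
- apply/seteqP; split.
    move=> _ [y [a [b [c [abc yabc]]]] <-]; exists (a + v), (b + v), (c + v); split.
      by apply/mapP; exists (a, b, c).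
    by apply: triangle_translate; exists y.
  move=> y [_ [_ [_ [/mapP[[[a b] c] /= abc [-> -> ->]] yt]]]].
  exists (y - v); last by rewrite /move rot0m subrK.
  exists a, b, c; split => //.
  have := @triangle_translate (a + v) (b + v) (c + v) (- v) (y - v).
  by rewrite !addrK; apply; exists y => //; rewrite /move rot0m.
Qed.

Lemma cramer2 p q w : xx p * yy q - xx q * yy p != 0 ->
  w = ((xx w * yy q - yy w * xx q) / (xx p * yy q - xx q * yy p)) *: p
    + ((xx p * yy w - yy p * xx w) / (xx p * yy q - xx q * yy p)) *: q.
Proof.
by move=> D0; apply: planeP; rewrite !coordE; field.
Qed.

(* Cramer's rule: a small displacement changes the barycentric coordinates
   [s], [t], [u] by a small amount. *)
Lemma triangle_interior (a b c : plane R) (s t u : R) :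
  \det (row_mx (b - a) (c - a) : 'M[R]_2) != 0 ->
  0 < s -> 0 < t -> 0 < u -> s + t + u = 1 ->
  (triangle a b c)^° (s *: a + t *: b + u *: c).
Proof.
rewrite det_row2 => D0 s0 t0 u0 stu; apply/interior_eballP.
set p := b - a in D0; set q := c - a in D0.
set D := _ - _ in D0.
(* By Cramer's rule the barycentric coordinates change by at most [C * fnorm d] in total; the radius
   [m / (C + 1)] keeps this below the smallest coordinate [m]. *)
pose C := (`|xx p| + `|yy p| + `|xx q| + `|yy q|) / `|D|.
have C0 : 0 <= C by rewrite divr_ge0 ?addr_ge0 ?normr_ge0.
pose m := Num.min s (Num.min t u).
have m0 : 0 < m by rewrite !lt_min s0 t0 u0.
have [ms mt mu] : [/\ m <= s, m <= t & m <= u].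
  by rewrite !ge_min !lexx !orbT.
exists (m / (C + 1)); first by rewrite divr_gt0 // ltr_wpDl.
move=> z; rewrite eballE; set y := s *: a + _ + _; set d := z - y => dm.
pose be := (xx d * yy q - yy d * xx q) / D.
pose ga := (xx p * yy d - yy p * xx d) / D.
have dE : d = be *: p + ga *: q.
  exact: cramer2.
have hb : `|be| + `|ga| <= m.
  have hx := fnorm_coord d o0; have hy := fnorm_coord d o1.
  apply: (@le_trans _ _ (C * fnorm d)); last first.
    apply: (@le_trans _ _ (C * (m / (C + 1)))); first by rewrite ler_wpM2l // ltW.
    by rewrite mulrCA ler_piMr ?(ltW m0) // ler_pdivrMr ?mul1r ?lerDl // ltr_wpDl.
  rewrite /be /ga /C !normrM !normfV -mulrDl mulrAC ler_wpM2r ?invr_ge0 //.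
  apply: le_trans (lerD (ler_normB _ _) (ler_normB _ _)) _; rewrite !normrM.
  have := ler_wpM2l (normr_ge0 (yy q)) hx; have := ler_wpM2l (normr_ge0 (xx q)) hy.
  have := ler_wpM2l (normr_ge0 (xx p)) hy; have := ler_wpM2l (normr_ge0 (yy p)) hx.
  move=> *; lra.
have := ler_norm be; have := ler_norm ga; have := ler_norm (- be); have := ler_norm (- ga).
rewrite !normrN => h1 h2 h3 h4.
exists (s - be - ga), (t + be), (u + ga); split; [lra..|].
rewrite -(subrK y z) -/d dE /y /p /q.
by apply: planeP; rewrite !coordE; ring.
Qed.

(** Moving [x] slightly towards the centroid of a triangle that contains it makes all three
    barycentric coordinates positive. *)
Lemma polygon_regular A x (e : R) : polygon A -> A x -> 0 < e ->
  exists2 y, A^° y & eball x e y.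
Proof.
move=> [l [_ lD AE]]; rewrite {1}AE => -[a [b [c [abc [s [t [u [s0 t0 u0 stu xE]]]]]]]] e0.
pose m : plane R := 3^-1 *: a + 3^-1 *: b + 3^-1 *: c.
(* This ratio is at most 1 and satisfies [la * fnorm (m - x) < e]. *)
pose la := e / (fnorm (m - x) + e).
have N0 := fnorm_ge0 (m - x).
have la0 : 0 < la by rewrite divr_gt0 // ltr_wpDl.
have la1 : la <= 1 by rewrite ler_pdivrMr ?mul1r ?lerDr // ltr_wpDl.
exists (x + la *: (m - x)).
  have : (triangle a b c)^° (x + la *: (m - x)).
    rewrite (_ : x + _ = (s + la * (3^-1 - s)) *: a + (t + la * (3^-1 - t)) *: b
       + (u + la * (3^-1 - u)) *: c); last first.
      by rewrite xE; apply: planeP; rewrite !coordE; ring.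
    apply: triangle_interior; first exact: lD.
    - have : 0 <= (1 - la) * s by rewrite mulr_ge0 // subr_ge0.
      lra.
    - have : 0 <= (1 - la) * t by rewrite mulr_ge0 // subr_ge0.
      lra.
    - have : 0 <= (1 - la) * u by rewrite mulr_ge0 // subr_ge0.
      lra.
    - have -> : u = 1 - s - t by lra.
      by field.
  move=> /interior_eballP[r r0 h]; apply/interior_eballP; exists r => // y /h yt.
  by rewrite AE; exists a, b, c.
rewrite eballE addrAC subrr add0r fnormZ gtr0_norm // /la.
rewrite mulrAC ltr_pdivrMr; last by rewrite ltr_wpDl.
by rewrite ltr_pM2l // ltrDl.
Qed.

Lemma tiling_translate v (T : tiles R) : tiling T -> tiling (mvtil 0 v T).
Proof.
move=> [cT pT covT dT]; split.
- exact: card_le_trans (card_image_le _ _) cT.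
- by move=> _ [t Tt <-]; apply/polygon_translate/pT.
- apply/seteqP; split => // y _.
  have : setT (y - v) by [].
  rewrite -covT => -[t Tt yt]; exists (mvset 0 v t); first exact: mvtil_in.
  by exists (y - v) => //; rewrite /move rot0m subrK.
- move=> _ _ [s Ts <-] [t Tt <-] st; rewrite !mvset_interior.
  have := dT _ _ Ts Tt.
  move=> /(_ (fun e => st (congr1 _ e))) st0; apply/seteqP; split => // y [[y1 y1s <-] [y2 y2t]].
  rewrite /move !rot0m => /addIr y12.
  have : (s^° `&` t^°) y1 by split => //; rewrite -y12.
  by rewrite st0.
Qed.

End Polygons.

(** * The tiling metric and the hull *)

Section TilingMetric.
Variable R : realType.
Implicit Types (T : tiles R) (v x y : plane R) (a b d e : R).

Lemma eps_closeP T T' e : eps_close T T' e <->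
  [/\ 0 < e, e < 1 & exists a x b y,
     [/\ fnorm x + fnorm (rot a - rot 0) < e,
         fnorm y + fnorm (rot b - rot 0) < e &
         patch_in_ball (mvtil a (rot a *m x) T) 0 e^-1 =
         patch_in_ball (mvtil b (rot b *m y) T') 0 e^-1]].
Proof.
split=> -[e0 e1].
  move=> [[x a] [[y b] [ga gb]]]; rewrite !isom_actE /= => h.
  by split=> //; exists a, x, b, y; move: ga gb; rewrite /isom_dist /= !subr0.
move=> [a [x [b [y [ga gb h]]]]]; split => //; exists (x, a), (y, b).
by rewrite !isom_actE /isom_dist /= !subr0.
Qed.

Lemma eps_close_lbound T T' : has_lbound [set e | eps_close T T' e].
Proof. by exists 0 => e [/ltW]. Qed.

Lemma dGamma_lt_eps_close T T' e : e <= 1 -> dGamma T T' < e ->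
  exists2 d, d < e & eps_close T T' d.
Proof.
rewrite /dGamma => e1; case: asboolP => [ex|_]; last by rewrite ltNge e1.
by move=> /(inf_lt ex)[d /= dT de]; exists d.
Qed.

Lemma eps_close_dGamma T T' e : eps_close T T' e -> dGamma T T' <= e.
Proof.
move=> h; rewrite /dGamma; case: asboolP => [_|[]]; last by exists e.
exact: (ge_inf (eps_close_lbound T T')).
Qed.

Lemma dGammaC T T' : dGamma T T' = dGamma T' T.
Proof.
have h S S' e : eps_close S S' e -> eps_close S' S e.
  by move=> [e0 e1 [g [g' [? ? ?]]]]; split => //; exists g', g.
rewrite /dGamma (_ : eps_close T T' = eps_close T' T) //.
by apply/funext => e; apply/propext; split; exact: h.
Qed.

Lemma dGamma_ge0 T T' : 0 <= dGamma T T'.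
Proof.
rewrite /dGamma; case: asboolP => // ex; apply: lb_le_inf => //.
by move=> e [/ltW].
Qed.

Lemma dGamma_rot T T' a b e : 0 < e -> e < 1 -> fnorm (rot a - rot b) < e ->
  patch_in_ball T 0 e^-1 = patch_in_ball T' 0 e^-1 ->
  dGamma (mvtil a 0 T) (mvtil b 0 T') <= e.
Proof.
move=> e0 e1 ab TT'; apply: eps_close_dGamma; apply/eps_closeP; split => //.
(* Rotating the first tiling further by [b - a] gives both the angle [b]; the second one stays
   fixed. *)
exists (b - a), 0, 0, 0; rewrite !rot_mx0 subrr fnorm0 !add0r; split.
- by rewrite fnorm_rotB1 fnorm_rotBC.
- by rewrite /fnorm big1 ?sqrtr0 // => i _; rewrite big1 // => j _; rewrite !mxE expr0n.
- rewrite !mvtil_comp rot_mx0 addr0 subrK add0r rot_mx0 addr0.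
  by apply: patch_move TT'; rewrite fnorm0 add0r.
Qed.

Variable D : tiling_data R.

Lemma OmegaP T : Omega D T <-> tiling T /\
  forall e, 0 < e -> exists x, exists2 d, d < e & eps_close (mvtil 0 x (base_tiling D)) T d.
Proof.
split=> -[tT h]; split => // e e0.
  have m0 : 0 < Num.min e 1 by rewrite lt_min e0 /=.
  have [x xm] := h _ m0; exists x.
  have m1 : Num.min e 1 <= 1 by rewrite ge_min lexx orbT.
  have [d dm dT] := dGamma_lt_eps_close m1 xm.
  by exists d; [move: dm; rewrite lt_min => /andP[]|rewrite -translateE].
have [x [d de dT]] := h e e0; exists x; apply: le_lt_trans de.
by apply: eps_close_dGamma; rewrite translateE.
Qed.

(* If [g (T + x)] and [g' T'] agree on a large ball, so do [g (T + x')] and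
   [g' (T' + v)] on a slightly smaller one, for the vector [x'] that makes
   [g (T + x')] a translate of [g (T + x)] by the rotation of [v] by [g']. *)
Lemma Omega_translate T v : Omega D T -> Omega D (mvtil 0 v T).
Proof.
move=> /OmegaP[tT hT]; apply/OmegaP; split; first exact: tiling_translate.
move=> e e0; pose c := Num.min (e / 2) 2^-1.
have c0 : 0 < c by rewrite lt_min divr_gt0 //= invr_gt0.
have [ce c1] : c < e /\ c < 1.
  by split; rewrite gt_min; apply/orP; [left; lra|right; rewrite invf_lt1 ?ltr1n].
have v0 := fnorm_ge0 v.
have C0 : 0 < fnorm v + c^-1 by rewrite ltr_wpDl // invr_gt0.
(* Agreement is requested on a ball of radius [fnorm v + c^-1], so that radius [c^-1] remains after
   a translation of length [fnorm v]. *)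
have [x [d dC /eps_closeP[d0 d1 [a [y [b [z [ay bz h]]]]]]]] := hT (fnorm v + c^-1)^-1 (etrans (invr_gt0 _) C0).
have dC' : fnorm v + c^-1 <= d^-1.
  by rewrite -[leLHS]invrK lef_pV2 ?posrE ?invr_gt0 // ltW.
have dc : d <= c by rewrite -lef_pV2 ?posrE //; apply: le_trans dC'; rewrite lerDr.
exists (x + rot (b - a) *m v); exists c => //; apply/eps_closeP; split => //.
exists a, y, b, z; split; [exact: lt_le_trans dc..|].
have := @patch_move _ 0 (rot b *m v) _ _ _ c^-1 _ h.
rewrite fnorm_rot => /(_ dC').
rewrite !mvtil_comp !rot0m !addr0 !add0r.
rewrite !mulmxDr rotDm (addrC a) subrK.
by rewrite -!addrA !(addrC (rot b *m v)).
Qed.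

(** The hull is closed under local limits: a translate of the base tiling close to [T'] is close to
    [T] as well, once [T'] and [T] agree on a large ball. *)
Lemma Omega_limit T : tiling T ->
  (forall r : R, exists2 T', Omega D T' & patch_in_ball T' 0 r = patch_in_ball T 0 r) ->
  Omega D T.
Proof.
move=> tT hT; apply/OmegaP; split => // e e0.
pose c := Num.min (e / 2) 2^-1.
have c0 : 0 < c by rewrite lt_min divr_gt0 //= invr_gt0.
have [ce c1] : c < e /\ c < 1.
  by split; rewrite gt_min; apply/orP; [left; lra|right; rewrite invf_lt1 ?ltr1n].
(* The extra 1 absorbs the translation [z], which is shorter than 1. *)
have [T' OT' TT'] := hT (1 + c^-1).
have /OmegaP[_ hT'] := OT'.
have [x [d dc /eps_closeP[d0 d1 [a [y [b [z [ay bz h]]]]]]]] := hT' c c0.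
have cd : c^-1 <= d^-1 by rewrite lef_pV2 ?posrE // ltW.
exists x, c => //; apply/eps_closeP; split => //.
exists a, y, b, z; split; [exact: lt_trans dc..|].
rewrite (patch_sub cd h); apply: patch_move TT'.
rewrite fnorm_rot lerD2r; have := fnorm_ge0 z; have := sqrtr_ge0 (\sum_i \sum_j (rot b - rot 0) i j ^+ 2).
rewrite -/(fnorm _); lra.
Qed.

End TilingMetric.

(** * Tiles and punctures *)

Section Angles.
Variable R : realType.

(** The arc cosine has the right cosine; when the sine of [a] is negative, its complement to
    [2 * pi] has the right sine too. *)
Lemma angle_repr (a : R) : exists2 b : R, 0 <= b < 2 * pi & rot b = rot a.
Proof.
have c1 : -1 <= cos a <= 1 by rewrite cos_geN1 cos_le1.
have cI : cos a \in `[(-1), 1] by rewrite in_itv.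
have h0 := acos_ge0 c1; have hpi := acos_lepi c1; have p0 := pi_gt0 R.
have hs : sin (acos (cos a)) = `|sin a|.
  by rewrite sin_acos // -sin2cos2 sqrtr_sqr.
have [s0|s0] := leP 0 (sin a).
  exists (acos (cos a)); first by rewrite h0 /=; lra.
  by apply/rot_cos_sin; rewrite acosK // hs ger0_norm.
have g0 : acos (cos a) != 0.
  by apply/eqP => h; move: hs; rewrite h sin0 => /esym/eqP; rewrite normr_eq0 lt_eqF.
exists (2 * pi - acos (cos a)).
  apply/andP; split; first lra.
  by rewrite ltrBlDr ltrDl lt_neqAle eq_sym g0.
apply/rot_cos_sin; rewrite cosB sinB [2 * pi]mulrC mulr_natr cos2pi sin2pi.
rewrite acosK // hs ltr0_norm // !mul0r !mul1r !addr0 sub0r opprK; split => //.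
Qed.

Lemma rot_angleB (a b : R) : rot (a - b) = rot 0 -> rot a = rot b.
Proof. by move=> h; rewrite -(subrK b a) addrC (rot_eqD b h) addr0. Qed.

End Angles.

(** The minimum of finitely many choices works; the initial value 1 covers [n = 0]. *)
Lemma ord_uniform_pos (R : realType) n (P : 'I_n -> R -> Prop) :
  (forall i, exists2 e, 0 < e & P i e) ->
  (forall i e d, P i e -> 0 < d -> d <= e -> P i d) ->
  exists2 e, 0 < e & forall i, P i e.
Proof.
move=> exP mono.
have [|f fP] := @choice _ _ (fun (i : 'I_n) (e : R) => 0 < e /\ P i e).
  by move=> i; have [e] := exP i; exists e.
exists (\big[Num.min/1]_i f i).
  by apply/bigmin_gtP; split => // i _; have [] := fP i.
move=> i; apply: (mono _ (f i)); first by have [] := fP i.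
  by apply/bigmin_gtP; split => // j _; have [] := fP j.
exact: bigmin_le.
Qed.

Section Standing.
Variables (R : realType) (D : tiling_data R) (HD : standing D).
Implicit Types (T : tiles R) (v x y : plane R) (a b d e : R) (s t : set (plane R)).

Lemma mvset_isom a v A : mvset a v A = isom_act_set (rot (- a) *m v, a) A.
Proof. by rewrite isom_act_setE /= rotNKm. Qed.

Lemma isom_act_pt_punc (g : isom R) (i : 'I_(nproto D)) :
  isom_act_pt g (proto_punc i) = rot g.2 *m g.1.
Proof. by rewrite isom_act_ptE (proto_punc0 HD) /move rot_mx0 add0r. Qed.

(** Unrelated proto-tiles give the same index; one puncture per tile gives the same vector; the
    remaining rotation fixes a pointed proto-tile, hence is trivial. *)
Lemma proto_rigid a b v w (i j : 'I_(nproto D)) :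
  mvset a v (proto i) = mvset b w (proto j) -> [/\ i = j, v = w & rot a = rot b].
Proof.
move=> h.
have ij : i = j.
  apply: contrapT => ij.
  have /eqP := congr1 (mvset (- b) (- (rot (- b) *m w))) h.
  by rewrite mvsetK mvset_comp mvset_isom => /eqP; exact: proto_unrelated.
subst j.
have vw : v = w.
  move: h; rewrite !mvset_isom => /(punc_well_defined HD).
  by rewrite !isom_act_pt_punc /= !rotNKm.
subst w; split => //; apply: rot_angleB.
have := congr1 (mvset (- b) (- (rot (- b) *m v))) h.
rewrite mvsetK mvset_comp subrr mvset_isom addrC => /(proto_pointed_asym HD).
by rewrite isom_act_pt_punc /= mulmx0 rot_mx0 (proto_punc0 HD) rot_angle0 => -[].
Qed.

Definition istile t := exists (i : 'I_(nproto D)) a v, t = mvset a v (proto i).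

Lemma punc_proto a v (i : 'I_(nproto D)) : punc D (mvset a v (proto i)) = v.
Proof.
apply: xget_unique.
  by exists (rot (- a) *m v, a), i; rewrite mvset_isom isom_act_pt_punc /= rotNKm.
move=> y [g [j [+ ->]]]; rewrite isom_act_setE isom_act_pt_punc.
by move=> /proto_rigid[].
Qed.

(** Equality of rotation matrices expresses equality of angles modulo [2 * pi]. *)
Lemma tile_angle_proto a v (i : 'I_(nproto D)) :
  rot (tile_angle D (mvset a v (proto i))) = rot a.
Proof.
rewrite /tile_angle; case: xgetP => [b _ [_ [j [w]]]|no].
  by rewrite translate_setE rot_setE mvset_comp add0r => /proto_rigid[].
have [b b2 ba] := angle_repr a; exfalso; apply: (no b); split => //.
exists i, v; rewrite translate_setE rot_setE mvset_comp add0r rot_mx0 add0r.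
exact: mvset_rot.
Qed.

Lemma istile_move a v t : istile t -> istile (mvset a v t).
Proof.
by move=> [i [b [w ->]]]; exists i; rewrite mvset_comp; eexists; eexists.
Qed.

Lemma punc_move a v t : istile t -> punc D (mvset a v t) = rot a *m punc D t + v.
Proof. by move=> [i [b [w ->]]]; rewrite mvset_comp !punc_proto. Qed.

Lemma angle_move a v t : istile t ->
  rot (tile_angle D (mvset a v t)) = rot (a + tile_angle D t).
Proof.
move=> [i [b [w ->]]]; rewrite mvset_comp !tile_angle_proto; apply: rot_eqD.
by rewrite tile_angle_proto.
Qed.

Lemma istileE t : istile t ->
  exists i : 'I_(nproto D), t = mvset (tile_angle D t) (punc D t) (proto i).
Proof.
move=> [i [a [v ->]]]; exists i; rewrite punc_proto; apply: mvset_rot.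
by rewrite tile_angle_proto.
Qed.

Lemma tile_rigid a b v w t : istile t -> mvset a v t = mvset b w t -> rot a = rot b.
Proof.
move=> [i [c [u ->]]]; rewrite !mvset_comp => /proto_rigid[_ _].
rewrite ![_ + c]addrC => h.
by have := rot_eqD (- c) h; rewrite !addKr.
Qed.

Lemma Omega_tile T t : Omega D T -> T t -> istile t.
Proof.
move=> OT Tt; have [g [i ->]] := tiles_proto HD OT Tt.
by rewrite isom_act_setE; exists i; eexists; eexists.
Qed.

Lemma Omega_move T a v : Omega D T -> Omega D (mvtil a v T).
Proof.
move=> OT; have := Omega_translate v (rot_invariant HD a OT).
by rewrite rotateE mvtil_comp rot_mx0 !add0r.
Qed.

Lemma inner_radius : exists2 r : R, 0 < r & forall t, istile t -> eball (punc D t) r `<=` t.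
Proof.
have [||r r0 h] := @ord_uniform_pos R (nproto D) (fun i r => eball 0 r `<=` proto i).
- move=> i; have /interior_eballP := proto_punc_interior HD i.
  by rewrite (proto_punc0 HD).
- by move=> i e d ie d0 de; apply: subset_trans ie; apply: sub_eball; rewrite subrr fnorm0 add0r.
exists r => // t [i [a [v ->]]]; rewrite punc_proto.
have := mvset_sub (a := a) (v := v) (h i).
by rewrite mvset_eball /move rot_mx0 add0r.
Qed.

Lemma outer_radius : exists2 M : R, 0 < M & forall t, istile t -> t `<=` eball (punc D t) M.
Proof.
(* The inverse radius serves as parameter, because the property must persist when the parameter
   decreases. *)
have [||r r0 h] := @ord_uniform_pos R (nproto D) (fun i r => proto i `<=` eball 0 r^-1).
- move=> i; have [M hM] := polygon_bounded (proto_polygon HD i).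
  exists (Num.max M 1)^-1; first by rewrite invr_gt0 lt_max ltr01 orbT.
  rewrite invrK; apply: subset_trans hM _; apply: sub_eball.
  by rewrite subrr fnorm0 add0r le_max lexx.
- move=> i e d ie d0 de; apply: (subset_trans ie); apply: sub_eball.
  by rewrite subrr fnorm0 add0r lef_pV2 // posrE //; exact: lt_le_trans de.
exists r^-1; first by rewrite invr_gt0.
move=> t [i [a [v ->]]]; rewrite punc_proto.
have := mvset_sub (a := a) (v := v) (h i).
by rewrite mvset_eball /move rot_mx0 add0r.
Qed.

Lemma eball_interior x r y A : eball x r `<=` A -> eball x r y -> A^° y.
Proof.
move=> xA xy; apply/interior_eballP; exists (r - fnorm (y - x)).
  by rewrite subr_gt0.
by apply: subset_trans xA; apply: sub_eball; rewrite addrC subrK.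
Qed.

Lemma Omega_disjoint T s t y : Omega D T -> T s -> T t -> s^° y -> t^° y -> s = t.
Proof.
move=> [[_ _ _ dT] _] Ts Tt sy ty; apply: contrapT => st.
have : (s^° `&` t^°) y by [].
by rewrite (dT _ _ Ts Tt st).
Qed.

(** Every tile contains a ball of fixed radius about its puncture, so tiles with closer punctures
    have overlapping interiors. *)
Lemma punc_sep : exists2 r : R, 0 < r & forall T s t, Omega D T -> T s -> T t ->
  fnorm (punc D s - punc D t) < r -> s = t.
Proof.
have [r r0 h] := inner_radius; exists r => // T s t OT Ts Tt st.
apply: (Omega_disjoint (y := punc D s) OT Ts Tt).
  apply: eball_interior (h s (Omega_tile OT Ts)) _.
  by rewrite eballE subrr fnorm0.
exact: eball_interior (h t (Omega_tile OT Tt)) _.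
Qed.

(** Any tile through the origin has interior points arbitrarily near it, hence inside the interior
    of [t]; so the choice in [tile0] is forced. *)
Lemma tile0E T t : Omega D T -> T t -> punc D t = 0 -> tile0 T = t.
Proof.
have [r r0 h] := inner_radius => OT Tt t0.
have := h t (Omega_tile OT Tt); rewrite t0 => rt.
apply: xget_unique; first by split => //; apply: rt; rewrite eballE subrr fnorm0.
move=> s [Ts s0]; have [[_ pT _ _] _] := OT.
have [y sy ry] := polygon_regular (pT s Ts) s0 r0.
exact: Omega_disjoint OT Ts Tt sy (eball_interior rt ry).
Qed.

(** Pigeonhole on a grid of side [p / 2]: punctures in one cell are closer than [p], so a tile is
    determined by its cell [f t]. Adding [r] makes the coordinates nonnegative before truncation. *)
Lemma patch_finite T x (r : R) : Omega D T -> finite_set (patch_in_ball T x r).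
Proof.
move=> OT; have [p p0 sep] := punc_sep; have [q q0 inn] := inner_radius.
pose f (t : set (plane R)) (i : 'I_2) : nat :=
  Num.truncn (((punc D t - x : plane R) i ord0 + r) / (p / 2)).
pose K : nat := (Num.truncn ((r + r) / (p / 2))).+1.
have p2 : 0 < p / 2 by rewrite divr_gt0.
have bnd t i : patch_in_ball T x r t ->
    0 <= ((punc D t - x : plane R) i ord0 + r) / (p / 2) < (r + r) / (p / 2).
  move=> [Tt tr].
  have : eball x r (punc D t).
    by apply/tr/(inn t (Omega_tile OT Tt)); rewrite eballE subrr fnorm0.
  rewrite eballE => h.
  have := le_lt_trans (fnorm_coord (punc D t - x : plane R) i) h.
  rewrite ltr_norml => /andP[h1 h2].
  by rewrite ltr_pM2r ?invr_gt0 // ltrD2r h2 andbT divr_ge0 ?(ltW p2) // -[X in _ <= _ + X]opprK subr_ge0 ltW.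
apply: (@card_le_finite _ _ _ (`I_K `*` `I_K)); last exact: finite_setX.
have fin : {in patch_in_ball T x r &, injective (fun t => (f t ord0, f t ord_max))}.
  move=> s t /set_mem sT /set_mem tT [h0 h1]; have [Ts _] := sT; have [Tt _] := tT.
  apply: (sep T) => //.
  have cell i : f s i = f t i -> `|(punc D s - punc D t : plane R) i ord0| < p / 2.
    rewrite /f => e.
    have /andP[s1 _] := bnd s i sT; have /andP[t1 _] := bnd t i tT.
    have /andP[s2 s3] := truncn_itv s1; have /andP[t2 t3] := truncn_itv t1.
    rewrite e in s2 s3; set k := Num.truncn _ in s2 s3 t2 t3.
    move: s2 s3 t2 t3; rewrite !ler_pdivlMr // !ltr_pdivrMr // !coordE -[k.+1%:R]natr1 mulrDl mul1r => s2 s3 t2 t3.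
    rewrite ltr_norml; apply/andP; split; lra.
  apply: le_lt_trans (fnorm_le_coord _) _.
  by have := cell _ h0; have := cell _ h1; lra.
rewrite -(card_le_eql (inj_card_eq fin)); apply: subset_card_le.
move=> _ [t tT <-]; split; rewrite /= /f ltnS.
  have /andP[h1 h2] := bnd t ord0 tT; apply: le_truncn; exact: ltW.
have /andP[h1 h2] := bnd t ord_max tT; apply: le_truncn; exact: ltW.
Qed.

End Standing.

(** * The punctured hull *)

Lemma finite_set_bounded (R : realType) (T : choiceType) (A : set T) (f : T -> R) :
  finite_set A -> exists M, forall x, A x -> f x <= M.
Proof.
move=> /finite_seqP[s ->]; elim: s => [|a s [M hM]]; first by exists 0.
exists (Num.max (f a) M) => x /=; rewrite inE => /orP[/eqP ->|/hM h].
  by rewrite le_max lexx.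
by rewrite le_max h orbT.
Qed.

Section PuncturedHull.
Variables (R : realType) (D : tiling_data R) (HD : standing D).
Implicit Types (T : tiles R) (v x y : plane R) (a b d e : R) (s t : set (plane R)).
Implicit Types (p q : Rpunc D).

Lemma Omega_punc_shift T t : Omega_punc D T -> T t ->
  Omega_punc D (mvtil 0 (- punc D t) T).
Proof.
move=> [OT _] Tt; split; first exact: Omega_move.
exists (mvset 0 (- punc D t) t); first exact: mvtil_in.
by rewrite (punc_move HD) ?rot0m ?subrr //; exact: (Omega_tile HD OT Tt).
Qed.

Lemma Omega_punc_rot T a : Omega_punc D T -> Omega_punc D (mvtil a 0 T).
Proof.
move=> [OT [t Tt t0]]; split; first exact: Omega_move.
exists (mvset a 0 t); first exact: mvtil_in.
by rewrite (punc_move HD) ?t0 ?rot_mx0 ?addr0 //; exact: (Omega_tile HD OT Tt).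
Qed.

Lemma tile0P T : Omega_punc D T -> T (tile0 T) /\ punc D (tile0 T) = 0.
Proof. by move=> [OT [t Tt t0]]; rewrite (tile0E HD OT Tt t0). Qed.

Lemma Rpunc_setP T1 T2 : Rpunc_set D (T1, T2) <->
  Omega_punc D T1 /\ exists2 t, T1 t & T2 = mvtil 0 (- punc D t) T1.
Proof.
split=> [[T [t [OT Tt [-> ->]]]]|[OT [t Tt ->]]].
  by split => //; exists t; rewrite // translateE.
by exists T1, t; rewrite translateE.
Qed.

Lemma Rpunc_refl T : Omega_punc D T -> Rpunc_set D (T, T).
Proof.
move=> OT; have [T0 z0] := tile0P OT; apply/Rpunc_setP; split => //.
by exists (tile0 T); rewrite // z0 oppr0 mvtil0.
Qed.

Lemma Rpunc_sym T1 T2 : Rpunc_set D (T1, T2) -> Rpunc_set D (T2, T1).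
Proof.
move=> /Rpunc_setP[OT [t Tt ->]]; have [T0 z0] := tile0P OT.
apply/Rpunc_setP; split; first exact: Omega_punc_shift.
exists (mvset 0 (- punc D t) (tile0 T1)); first exact: mvtil_in.
rewrite (punc_move HD) ?z0; last exact: (Omega_tile HD OT.1 T0).
by rewrite rot0m add0r opprK mvtil_comp rot0m addr0 addNr mvtil0.
Qed.

Lemma Rpunc_trans T1 T2 T3 :
  Rpunc_set D (T1, T2) -> Rpunc_set D (T2, T3) -> Rpunc_set D (T1, T3).
Proof.
move=> /Rpunc_setP[OT [t Tt ->]] /Rpunc_setP[_ [_ [s Ts <-] ->]].
apply/Rpunc_setP; split => //; exists s => //.
rewrite (punc_move HD); last exact: (Omega_tile HD OT.1 Ts).
by rewrite mvtil_comp !rot0m addr0 opprD opprK addrCA addNr addr0.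
Qed.

Lemma Rpunc_in p : Rpunc_set D (src p, tgt p).
Proof. by rewrite /src /tgt -surjective_pairing; apply/set_mem/(valP p). Qed.

Lemma srcP p : Omega_punc D (src p).
Proof. by have /Rpunc_setP[] := Rpunc_in p. Qed.

Lemma tgtP p : Omega_punc D (tgt p).
Proof. by have /Rpunc_sym/Rpunc_setP[] := Rpunc_in p. Qed.

Lemma period_unique T v w : Omega D T -> mvtil 0 v T = mvtil 0 w T -> v = w.
Proof.
move=> OT h; apply/eqP; rewrite -subr_eq0; apply/negP => /negP/eqP vw.
apply: (aperiodic HD OT vw); rewrite translateE.
have := congr1 (mvtil 0 (- w)) h.
by rewrite !mvtil_comp !rot0m addr0 addrN mvtil0.
Qed.

Lemma RvecP p : exists t, [/\ src p t, Rvec p = punc D t &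
   tgt p = mvtil 0 (- Rvec p) (src p)].
Proof.
rewrite /Rvec; case: xgetP => [y _ [t [st yE ->]]|no].
  by exists t; rewrite translateE.
have /Rpunc_setP[OT [t Tt tE]] := Rpunc_in p.
by exfalso; apply: (no (punc D t)); exists t; rewrite translateE.
Qed.

Lemma Rvec_unique p v : tgt p = mvtil 0 v (src p) -> Rvec p = - v.
Proof.
have [t [_ _ ->]] := RvecP p => /(period_unique (srcP p).1) <-.
by rewrite opprK.
Qed.

Lemma Rvec0 p : (src p = tgt p) <-> (Rvec p = 0).
Proof.
split=> h; first by rewrite (@Rvec_unique p 0) ?oppr0 // mvtil0.
by have [t [_ _ ->]] := RvecP p; rewrite h oppr0 mvtil0.
Qed.

(* Two punctured tilings that are close differ near the origin by a rotation
   only: the small translation matches a puncture close to the origin with the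
   puncture at the origin. *)
Lemma dGamma_close (K e : R) : 0 < e -> exists2 d, 0 < d &
  forall T1 T2, Omega_punc D T1 -> Omega_punc D T2 -> dGamma T1 T2 < d ->
  exists2 a, fnorm (rot a - rot 0) < e &
    patch_in_ball (mvtil a 0 T1) 0 K = patch_in_ball T2 0 K.
Proof.
move=> e0; have [M M0 out] := outer_radius HD; have [r r0 sep] := punc_sep HD.
(* Beyond the ball of radius [K] and the tile size [M], one unit absorbs the translation [y] and two
   more the displacement [u]. *)
pose C := `|K| + M + 3; have K0 := normr_ge0 K; have K1 := ler_norm K.
have C0 : 0 < C by rewrite /C; lra.
(* The three bounds serve, in order, to separate punctures, to keep the rotation small, and to make
   the ball of agreement large. *)
exists (Num.min (r / 2) (Num.min (e / 2) C^-1)).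
  by rewrite !lt_min invr_gt0 C0 !divr_gt0.
move=> T1 T2 [OT1 [s T1s s0]] [OT2 [t T2t t0]] h.
have d1 : Num.min (r / 2) (Num.min (e / 2) C^-1) <= 1.
  rewrite !ge_min [X in _ || (_ || X)](_ : _ = true) ?orbT //.
  by rewrite invf_le1 // /C; lra.
have [d] := dGamma_lt_eps_close d1 h.
rewrite !lt_min => /and3P[dr de dC] /eps_closeP[d0 d1' [a [x [b [y [ax b_y hp]]]]]].
have dC' : C <= d^-1 by rewrite -[C]invrK lef_pV2 ?posrE ?invr_gt0 // ltW.
have n1 := fnorm_ge0 x; have n2 := fnorm_ge0 y.
have n3 : 0 <= fnorm (rot a - rot 0 : 'M[R]_2) by exact: sqrtr_ge0.
have n4 : 0 <= fnorm (rot b - rot 0 : 'M[R]_2) by exact: sqrtr_ge0.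
have := @patch_move _ (- b) (- y) _ _ _ (C - 1) _ hp.
rewrite fnormN !mvtil_comp => /(_ ltac:(lra)).
rewrite !rotKm addNr addrN mvtil0 rotDm.
set u := rot _ *m x - y => hp'.
have un : fnorm u < d + d.
  by apply: le_lt_trans (fnorm_triangle _ _) _; rewrite fnorm_rot fnormN; lra.
have T2s : T2 (mvset (- b + a) u s).
  have : patch_in_ball (mvtil (- b + a) u T1) 0 (C - 1) (mvset (- b + a) u s).
    split; first exact: mvtil_in.
    have ist := Omega_tile HD OT1 T1s.
    apply: (subset_trans (out _ (istile_move _ _ ist))).
    rewrite (punc_move HD) // s0 rot_mx0 add0r; apply: sub_eball.
    rewrite subr0 /C; lra.
  by rewrite hp' => -[].
(* The moved tile has puncture [u], too close to the puncture 0 of [t] for the two tiles to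
   differ. *)
have u0 : u = 0.
  have ist := Omega_tile HD OT1 T1s.
  have pu : punc D (mvset (- b + a) u s) = u by rewrite (punc_move HD) // s0 rot_mx0 add0r.
  by rewrite -pu (sep T2 (mvset (- b + a) u s) t OT2) // pu t0 subr0; lra.
exists (- b + a).
  rewrite [- b + a]addrC fnorm_rotB1; apply: le_lt_trans (fnorm_rot_triangle _ 0 _) _.
  rewrite (fnorm_rotBC 0); lra.
by move: hp'; rewrite u0; apply: patch_sub; rewrite /C; lra.
Qed.

Lemma dRC p q : dR p q = dR q p.
Proof. by rewrite /dR dGammaC fnormBC. Qed.

Lemma dR_lt p q e : dR p q < e -> dGamma (src p) (src q) < e /\ fnorm (Rvec p - Rvec q) < e.
Proof.
rewrite /dR => h; have := dGamma_ge0 (src p) (src q); have := fnorm_ge0 (Rvec p - Rvec q).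
by split; lra.
Qed.

Lemma VsetP (P : tiles R) t t' p : Vset P t t' p <-> exists a,
  mvtil a (- (rot a *m punc D t)) P `<=` src p /\
  tgt p = mvtil 0 (- (rot a *m (punc D t' - punc D t))) (src p).
Proof.
have E a : rotate a (translate (- punc D t) P) = mvtil a (- (rot a *m punc D t)) P.
  by rewrite rotateE translateE mvtil_comp mulmxN !addr0.
by split=> -[a [h1 h2]]; exists a; move: h1 h2; rewrite E translateE.
Qed.

Lemma patch_tile (P : tiles R) t : is_patch D P -> P t -> istile D t.
Proof. by move=> [_ [T [OT _] PT]] /PT; exact: (Omega_tile HD). Qed.

(** A nearby source contains the copy of [P] turned by a further small angle [b]. The puncture
    [Rvec q] is then close to that of the turned copy of [t'], hence equal to it. *)
Lemma Vset_near (P : tiles R) t t' : is_patch D P -> P t -> P t' ->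
  exists2 d, 0 < d & forall p q, dR p q < d -> Vset P t t' p -> Vset P t t' q.
Proof.
move=> hP Pt Pt'; have [M M0 out] := outer_radius HD; have [r r0 sep] := punc_sep HD.
have [L hL] := finite_set_bounded (fun s => fnorm (punc D s - punc D t)) hP.1.
pose N := fnorm (punc D t' - punc D t); have N0 : 0 <= N := fnorm_ge0 _.
(* A rotation this small moves [Rvec p], of length [N], by less than [r / 2]; the distance from
   [Rvec p] to [Rvec q] takes the other half. *)
have e0 : 0 < r / 2 / (N + 1) by rewrite !divr_gt0 // ltr_wpDl.
have [d d0 close] := dGamma_close (L + M) e0.
exists (Num.min d (r / 2)); first by rewrite lt_min d0 divr_gt0.
move=> p q /dR_lt[]; rewrite !lt_min => /andP[pqd _] /andP[_ pqr].
move=> /VsetP[a [Pp tp]].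
have [b bN pq] := close _ _ (srcP p) (srcP q) pqd.
have sub : mvtil (b + a) (- (rot (b + a) *m punc D t)) P `<=` src q.
  move=> _ [s Ps <-].
  have ist := patch_tile hP Ps.
  suff : patch_in_ball (mvtil b 0 (src p)) 0 (L + M)
    (mvset (b + a) (- (rot (b + a) *m punc D t)) s) by rewrite pq => -[].
  split.
    exists (mvset a (- (rot a *m punc D t)) s); first by apply: Pp; exact: mvtil_in.
    by rewrite mvset_comp mulmxN rotDm addr0.
  apply: subset_trans (out _ (istile_move _ _ ist)) _; apply: sub_eball.
  by rewrite subr0 (punc_move HD) // -mulmxBr fnorm_rot lerD2r; exact: hL.
have Rp := Rvec_unique tp; rewrite opprK in Rp.
have [s [sq Rq tq]] := RvecP q.
have sE : s = mvset (b + a) (- (rot (b + a) *m punc D t)) t'.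
  apply: (sep (src q)) => //.
  - exact: (srcP q).1.
  - by apply: sub; exact: mvtil_in.
  rewrite -Rq (punc_move HD); last exact: patch_tile hP Pt'.
  rewrite -mulmxBr -rotDm -Rp.
  rewrite -(subrK (Rvec p) (Rvec q)) -addrA; apply: le_lt_trans (fnorm_triangle _ _) _.
  rewrite (splitr r) fnormBC ltrD // -{1}(rot0m (Rvec p)) fnormBC.
  apply: le_lt_trans (fnorm_rotB _ _ _) _.
  have -> : fnorm (Rvec p) = N by rewrite Rp fnorm_rot.
  apply: (@le_lt_trans _ _ (fnorm (rot b - rot 0 : 'M[R]_2) * (N + 1))).
    by rewrite ler_wpM2l ?sqrtr_ge0 // lerDl.
  by rewrite -ltr_pdivlMr // ltr_wpDl.
apply/VsetP; exists (b + a); split => //; rewrite tq Rq sE (punc_move HD).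
  by rewrite -mulmxBr.
exact: patch_tile hP Pt'.
Qed.

(** [Rvec q] is a puncture of [src q] closer to the puncture 0 than the separation allows. *)
Lemma diag_near : exists2 d, 0 < d & forall p q, dR p q < d -> src p = tgt p -> src q = tgt q.
Proof.
have [r r0 sep] := punc_sep HD; exists r => // p q /dR_lt[_ h] /Rvec0 p0.
apply/Rvec0; have [s [sq Rq _]] := RvecP q; have [T0 z0] := tile0P (srcP q).
move: h; rewrite p0 sub0r fnormN Rq => h.
by rewrite -z0; congr punc; apply: (sep (src q)) => //; rewrite ?z0 ?subr0 //; exact: (srcP q).1.
Qed.

End PuncturedHull.

(** * Compactness *)

(** Induction on a list of the values: an ultrafilter contains the fibre over the head or its
    complement. *)
Lemma ultra_finite (T : Type) (U : choiceType) (F : set_system T) (f : T -> U) (S : set U) :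
  UltraFilter F -> finite_set S -> F [set x | S (f x)] ->
  exists2 s, S s & F [set x | f x = s].
Proof.
move=> UF /finite_seqP[l ->]; elim: l => [|a l IH] FS.
  by have [x] := filter_ex FS.
have [h|h] := in_ultra_setVsetC [set x | f x = a] UF.
  by exists a => //=; rewrite inE eqxx.
have [|s sl Fs] := IH; last by exists s => //=; rewrite inE (sl : is_true (s \in l)) orbT.
apply: filterS (filterI FS h) => x [] /=.
by rewrite inE => /orP[/eqP ->|].
Qed.

Lemma subset1_finite (T : Type) (A : set T) : is_subset1 A -> finite_set A.
Proof.
move=> A1; have [->|/set0P[x Ax]] := eqVneq A set0; first exact: finite_set0.
by apply: (@sub_finite_set _ _ [set x]); [move=> y /(A1 x y Ax)|exact: finite_set1].
Qed.

Lemma fnorm_rotB_le (R : realType) (a b : R) :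
  fnorm (rot a - rot b) <= 2 * (`|cos a - cos b| + `|sin a - sin b|).
Proof.
rewrite fnorm_rotBE -(@ler_pXn2r _ 2) ?nnegrE ?sqrtr_ge0 ?mulr_ge0 ?addr_ge0 //.
rewrite sqr_sqrtr ?mulr_ge0 ?addr_ge0 ?sqr_ge0 //.
rewrite exprMn [X in _ <= _ * X]sqrrD !real_normK ?num_real //.
have := mulr_ge0 (normr_ge0 (cos a - cos b)) (normr_ge0 (sin a - sin b)).
have := sqr_ge0 (cos a - cos b); have := sqr_ge0 (sin a - sin b).
move: (_ ^+ 2) (_ ^+ 2) (_ * `|_|) => x y z; lra.
Qed.

Lemma rot_near (R : realType) (c e : R) : 0 < e ->
  \forall b \near c, fnorm (rot c - rot b) < e.
Proof.
move=> e0; have e4 : 0 < e / 4 by rewrite divr_gt0.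
have /cvgrPdist_lt/(_ _ e4) hc := @continuous_cos R c.
have /cvgrPdist_lt/(_ _ e4) hs := @continuous_sin R c.
near=> b; apply: le_lt_trans (fnorm_rotB_le _ _) _.
have h1 : `|cos c - cos b| < e / 4 by near: b.
have h2 : `|sin c - sin b| < e / 4 by near: b.
lra.
Unshelve. all: by end_near. Qed.

Section Compactness.
Variables (R : realType) (D : tiling_data R) (HD : standing D).
Implicit Types (T : tiles R) (v : plane R) (a b d e : R) (s t : set (plane R)).
Implicit Types (p q : Rpunc D).

Lemma tile_rigid_vec a b v w t : istile D t -> mvset a v t = mvset b w t -> v = w.
Proof.
move=> ht h; have r := tile_rigid HD ht h.
by have := congr1 (punc D) h; rewrite !(punc_move HD) // r => /addrI.
Qed.

(* A patch in the ball is a copy [g Q0] of one of finitely many patches, and [g]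
   is determined by the tile of [Q0] that it moves onto the proto-tile. *)
Lemma proto_patches_finite (r : R) : 0 < r ->
  (forall i : 'I_(nproto D), proto i `<=` eball 0 r) ->
  finite_set [set Q | exists T, [/\ Omega D T, exists i : 'I_(nproto D), T (proto i)
                                  & Q = patch_in_ball T 0 r]].
Proof.
move=> r0 hr; set S := [set Q | _].
(* Finite local complexity bounds the number of orbits, so it remains to bound the members of [S] in
   one orbit. *)
have : S `<=` \bigcup_(O in [set isom_orbit Q | Q in patches D r])
    [set Q | S Q /\ isom_orbit Q = O].
  move=> Q SQ; exists (isom_orbit Q) => //; exists Q => //.
  by have [T [OT _ ->]] := SQ; exists T, 0.
move/sub_finite_set; apply; apply: bigcup_finite; first exact: FLC.
move=> O _.
have [->|/set0P[Q0 [SQ0 OQ0]]] := eqVneq [set Q | S Q /\ isom_orbit Q = O] set0.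
  exact: finite_set0.
have : [set Q | S Q /\ isom_orbit Q = O] `<=`
    \bigcup_(i in [set: 'I_(nproto D)]) \bigcup_(s in Q0)
    [set Q | exists a v, Q = mvtil a v Q0 /\ mvset a v s = proto i].
  move=> Q [SQ OQ]; have : isom_orbit Q0 Q.
    rewrite OQ0 -OQ; exists (0, 0) => //.
    by rewrite isom_actE /= rot_mx0 mvtil0.
  move=> [g _ gQ]; move: gQ; rewrite isom_actE => gQ.
  have [T [OT [i Ti] QE]] := SQ.
  have : Q (proto i) by rewrite QE; split.
  rewrite -{1}gQ => -[s Q0s si]; exists i => //; exists s => //.
  by exists g.2, (rot g.2 *m g.1).
move/sub_finite_set; apply; apply: bigcup_finite => [|i _]; first exact: finite_finset.
have [T0 [OT0 _ Q0E]] := SQ0.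
apply: bigcup_finite => [|s Q0s]; first by rewrite Q0E; exact: (patch_finite HD).
apply: subset1_finite => Q Q' [a [v [-> h]]] [b [w [-> h']]].
have ist : istile D s by move: Q0s; rewrite Q0E => -[/(Omega_tile HD OT0)].
have e : mvset a v s = mvset b w s by rewrite h h'.
by rewrite (tile_rigid_vec ist e); apply: mvtil_rot; exact: (tile_rigid HD ist e).
Qed.

(** The limit [T] consists of the tiles that [N x] contains for [F]-almost all [x]. With a
    proto-tile in each [N x], finiteness holds for the patches themselves and not only modulo
    isometries. *)
Lemma Omega_ultralimit (X : Type) (F : set_system X) (N : X -> tiles R) :
  UltraFilter F -> (forall x, Omega D (N x)) ->
  (forall x, exists i : 'I_(nproto D), N x (proto i)) ->
  exists T, [/\ Omega D T, exists i : 'I_(nproto D), T (proto i) &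
    forall r : R, F [set x | patch_in_ball (N x) 0 r = patch_in_ball T 0 r]].
Proof.
move=> UF ON Ni; have [M M0 out] := outer_radius HD.
pose T : tiles R := [set t | F [set x | N x t]].
have protoM (i : 'I_(nproto D)) : proto i `<=` eball 0 M.
  have ist : istile D (proto i) by exists i, 0, 0; rewrite mvset0.
  by have := out _ ist; rewrite -{2}(mvset0 (proto i)) (punc_proto HD).
have agree (r : R) : F [set x | patch_in_ball (N x) 0 r = patch_in_ball T 0 r].
  (* Radius at least [M] puts every proto-tile inside the ball. *)
  pose r' := Num.max r M.
  have rr' : r <= r' by rewrite le_max lexx.
  have r'M : M <= r' by rewrite le_max lexx orbT.
  have r'0 : 0 < r' := lt_le_trans M0 r'M.
  have pr' (i : 'I_(nproto D)) : proto i `<=` eball 0 r'.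
    by apply: subset_trans (protoM i) _; apply: sub_eball; rewrite subrr fnorm0 add0r.
  have [|Q _ FQ] := @ultra_finite _ _ F (fun x => patch_in_ball (N x) 0 r') _ UF
    (proto_patches_finite r'0 pr').
    by apply: filterS filterT => x _; exists (N x).
  apply: (filterS _ FQ) => x /= xQ; apply: (patch_sub rr'); rewrite xQ.
  apply/seteqP; split => t.
    move=> Qt; split; last by move: Qt; rewrite -xQ => -[].
    by apply: (filterS _ FQ) => y /= yQ; move: Qt; rewrite -yQ => -[].
  move=> [Tt tr']; have [y [/= Ny yQ]] := filter_ex (filterI (Tt : F _) FQ).
  by rewrite -yQ.
have Ttile t : T t -> exists x, N x t by move=> Tt; have [x] := filter_ex (Tt : F _); exists x.
have Tist t : T t -> istile D t by move=> /Ttile[x]; exact: (Omega_tile HD (ON x)).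
exists T; split => //; last first.
  have [x xT] := filter_ex (agree M); have [i Nxi] := Ni x; exists i.
  have : patch_in_ball (N x) 0 M (proto i) by split.
  by rewrite xT => -[].
apply: Omega_limit; last first.
  by move=> r; have [x xT] := filter_ex (agree r); exists (N x).
split.
- have -> : T = \bigcup_n patch_in_ball T 0 n%:R.
    apply/seteqP; split => [t Tt|t [n _ []] //].
    exists (Num.truncn (fnorm (punc D t) + M)).+1 => //; split => //.
    apply: subset_trans (out _ (Tist _ Tt)) _; apply: sub_eball; rewrite subr0.
    exact/ltW/truncnS_gt.
  apply: bigcup_countable => // n _.
  have [x <-] := filter_ex (agree n%:R).
  have [[cN _ _ _] _] := ON x.
  by apply: sub_countable cN; apply: subset_card_le => t [].
- by move=> t /Ttile[x]; have [[_ pN _ _] _] := ON x; exact: pN.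
- apply/seteqP; split => // y _.
  (* A tile through [y] has its puncture within [M] of [y], and extends at most [M] beyond the
     puncture. *)
  have [x xT] := filter_ex (agree (fnorm y + M + M)).
  have [[_ _ cov _] _] := ON x.
  have : setT y by []; rewrite -cov => -[t Nt ty]; exists t => //.
  suff : patch_in_ball (N x) 0 (fnorm y + M + M) t by rewrite xT => -[].
  split => //; have ot := out _ (Omega_tile HD (ON x) Nt).
  apply: (subset_trans ot); apply: sub_eball; rewrite subr0 lerD2r.
  have := ot _ ty; rewrite eballE => h.
  rewrite -(subrK y (punc D t)) addrC; apply: le_trans (fnorm_triangle _ _) _.
  by rewrite lerD2l fnormBC ltW.
- move=> s t Ts Tt; have [x [/= Ns Nt]] := filter_ex (filterI (Ts : F _) (Tt : F _)).
  by have [[_ _ _ dN] _] := ON x; exact: dN.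
Qed.

Lemma tile_angle_itv t : tile_angle D t \in `[0, 2 * pi].
Proof.
rewrite in_itv /= /tile_angle; case: xgetP => [b _ [/andP[b0 b1] _]|_].
  by rewrite b0 ltW.
by rewrite lexx mulr_ge0 // pi_ge0.
Qed.

(** A cluster point exists in the compact interval, and an ultrafilter converges to its cluster
    points. The endpoint [2 * pi] is harmless, as only rotation matrices are compared. *)
Lemma ultra_angle (X : Type) (F : set_system X) (th : X -> R) :
  UltraFilter F -> (forall x, th x \in `[0, 2 * pi]) ->
  exists c, forall e, 0 < e -> F [set x | fnorm (rot c - rot (th x)) < e].
Proof.
move=> UF thI.
have PF : ProperFilter (th @ F) by exact: fmap_proper_filter.
have FI : (th @ F) [set` `[0, 2 * pi]].
  by apply: (@filterS _ F _ setT) => [x _|]; [exact: thI|exact: filterT].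
have [c [_ cl]] := @segment_compact R 0 (2 * pi) (th @ F) PF FI.
exists c => e e0.
have [//|h] := in_ultra_setVsetC [set x | fnorm (rot c - rot (th x)) < e] UF.
have [b [/= + hb]] := cl [set b | ~ fnorm (rot c - rot b) < e] _ h (rot_near c e0).
by rewrite hb.
Qed.

(** Each element is encoded by its angle [th p], the tiling [N p] with a proto-tile at the origin,
    and the vector [w p] turned back accordingly; each of the three has a limit along the
    ultrafilter. *)
Lemma Rvec_ball_compact (r : R) : compact [set p : Rpunc D | fnorm (Rvec p) <= r].
Proof.
rewrite compact_ultra => F UF FK.
have [M M0 out] := outer_radius HD.
pose th p := tile_angle D (tile0 (src p)).
pose N p := mvtil (- th p) 0 (src p).
pose w p := rot (- th p) *m Rvec p.
have srcE p : src p = mvtil (th p) 0 (N p).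
  by rewrite /N mvtil_comp rot_mx0 addr0 addrN mvtil0.
have ON p : Omega D (N p) by apply: Omega_move => //; exact: (srcP p).1.
have Ni p : exists i : 'I_(nproto D), N p (proto i).
  have [T0 z0] := tile0P HD (srcP p).
  have [i tE] := istileE HD (Omega_tile HD (srcP p).1 T0).
  exists i; exists (tile0 (src p)) => //.
  by rewrite tE z0 mvset_comp rot_mx0 addr0 -/(th p) addNr mvset0.
have [T [OT [i0 Ti0] agree]] := Omega_ultralimit UF ON Ni.
have [c hc] := ultra_angle UF (fun p => tile_angle_itv (tile0 (src p))).
(* [w p] is a puncture of a tile of [N p] inside this ball, hence a puncture of the limit [T]; so it
   takes finitely many values and is constant on a set of the ultrafilter. *)
have fin : finite_set (punc D @` patch_in_ball T 0 (r + M)).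
  by apply: finite_image; exact: (patch_finite HD).
have [|_ [t0 [Tt0 _] <-] Fw] := @ultra_finite _ _ F w _ UF fin.
  apply: filterS (filterI FK (agree (r + M))) => p [/= pr pT].
  have [t [st Rt _]] := RvecP p.
  have ist := Omega_tile HD (srcP p).1 st.
  have pw : punc D (mvset (- th p) 0 t) = w p by rewrite (punc_move HD) // addr0 -Rt.
  exists (mvset (- th p) 0 t) => //; rewrite -pT; split; first exact: mvtil_in.
  apply: (subset_trans (out _ (istile_move _ _ ist))); apply: sub_eball.
  by rewrite pw subr0 lerD2r fnorm_rot.
set w0 := punc D t0 in Fw.
have ist0 := Omega_tile HD OT Tt0.
have OpT : Omega_punc D T.
  split => //; exists (proto i0) => //.
  by rewrite -(mvset0 (proto i0)) (punc_proto HD).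
have p0P : (mvtil c 0 T, mvtil 0 (- (rot c *m w0)) (mvtil c 0 T)) \in Rpunc_set D.
  apply/mem_set/(Rpunc_setP); split; first exact: Omega_punc_rot.
  exists (mvset c 0 t0); first exact: mvtil_in.
  by rewrite (punc_move HD) // addr0.
pose p0 : Rpunc D := exist (fun z : tiles R * tiles R => z \in Rpunc_set D) _ p0P.
have Rp0 : Rvec p0 = rot c *m w0 by rewrite (@Rvec_unique _ _ HD p0 (- (rot c *m w0))) ?opprK.
exists p0; split.
  rewrite /= Rp0 fnorm_rot.
  have [p [/= pr <-]] := filter_ex (filterI FK Fw).
  by rewrite fnorm_rot.
move=> A; rewrite nbhsE => -[U [oU Up0] UA]; apply: filterS UA _.
have [e e0 He] := (oU : dR_open U) _ Up0; apply: (filterS He).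
have n0 := fnorm_ge0 w0.
(* The tilings contribute at most [d] and the vectors at most [d * fnorm w0]; the 2 in place of 1
   makes the final inequality strict. *)
pose d := Num.min 2^-1 (e / (fnorm w0 + 2)).
have d0 : 0 < d by rewrite lt_min invr_gt0 ltr0n divr_gt0 //; lra.
have d1 : d < 1 by rewrite gt_min invf_lt1 ?ltr1n.
have de : d * (fnorm w0 + 2) <= e.
  by rewrite -ler_pdivlMr; [rewrite ge_min lexx orbT|lra].
apply: (filterS _ (filterI (filterI (hc d d0) (agree d^-1)) Fw)) => q [[/= hq aq] wq].
have Rq : Rvec q = rot (th q) *m w0 by rewrite -wq /w rotNKm.
rewrite /dR Rp0 Rq (srcE q).
have h1 := dGamma_rot d0 d1 hq (esym aq).
have h2 := le_trans (fnorm_rotB c (th q) w0) (ler_wpM2r n0 (ltW hq)).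
apply: le_lt_trans (lerD h1 h2) _; apply: lt_le_trans de; lra.
Qed.

End Compactness.

(** * The functions [efun] and [zfun] *)

Section Expi.
Local Open Scope complex_scope.
Variable R : realType.
Implicit Types a b : R.

Lemma expi_rot a b : rot a = rot b -> expi a = expi b.
Proof. by move=> /rot_cos_sin[ec es]; rewrite /expi ec es. Qed.

Lemma expi0 : expi 0 = 1 :> R[i].
Proof. by rewrite /expi cos0 sin0. Qed.

Lemma expiD a b : expi (a + b) = expi a * expi b.
Proof. by rewrite /expi cosD sinD; apply/eqP; rewrite eq_complex /= eqxx addrC eqxx. Qed.

Lemma expiN a : expi (- a) = (expi a)^*.
Proof. by rewrite /expi cosN sinN. Qed.

Lemma expiMn (n : nat) a : expi (n%:R * a) = expi a ^+ n.
Proof.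
elim: n => [|n IH]; first by rewrite mul0r expi0.
by rewrite exprS -IH -expiD -natr1 mulrDl mul1r addrC.
Qed.

Lemma norm_expi a : `|expi a| = 1.
Proof. by rewrite normc_def /= cos2Dsin2 sqrtr1. Qed.

Lemma norm_expiB1 a : `|expi a - 1| <= (fnorm (rot a - rot 0))%:C.
Proof.
rewrite normc_def lecR fnorm_rotBE cos0 sin0 /= oppr0 addr0 ler_wsqrtr //.
by rewrite ler_peMl ?addr_ge0 ?sqr_ge0 ?ler1n.
Qed.

Lemma expi_neq0 a : expi a != 0.
Proof. by rewrite -normr_eq0 norm_expi oner_eq0. Qed.

(** Integer multiples respect angles modulo [2 * pi], which is all that a rotation matrix
    records. *)
Lemma expi_mulz (l : int) a b : rot a = rot b -> expi (l%:~R * a) = expi (l%:~R * b).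
Proof.
move=> /expi_rot h; case: l => n; first by rewrite -!pmulrn !expiMn h.
by rewrite NegzE mulrNz !mulNr -!pmulrn !expiN !expiMn h.
Qed.

End Expi.

Section Algebra.
Local Open Scope complex_scope.
Variables (R : realType) (D : tiling_data R) (HD : standing D).
Implicit Types (T : tiles R) (v : plane R) (a b d e : R) (s t : set (plane R)).
Implicit Types (p q : Rpunc D) (f g : Rpunc D -> R[i]) (P : tiles R).

(** * Continuity and compact support *)

Lemma open_dR (U : set (Rpunc D)) : open U = dR_open U. Proof. by []. Qed.

Lemma continuous_dR f :
  (forall p (e : R), 0 < e -> exists2 d, 0 < d & forall q, dR p q < d -> `|f p - f q| < e%:C) ->
  continuous (f : Rpunc D -> (R[i] : numFieldType)).
Proof.
move=> h; apply/continuousP => A oA; rewrite open_dR => p Ap.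
have /nbhs_ballP[[e e'] /= e0 eA] := open_nbhs_nbhs (conj oA Ap).
(* A positive complex radius has zero imaginary part. *)
move: e0; rewrite ltcE /= => /andP[/eqP e'0 e0].
have [d d0 hd] := h p e e0; exists d => // q /hd pq; apply: eA.
by rewrite /ball /= e'0.
Qed.

(** Symmetry of [dR] turns the uniform condition on [A] into openness of its complement. *)
Lemma near_closed (A : set (Rpunc D)) :
  (exists2 d, 0 < d & forall p q, dR p q < d -> A p -> A q) -> closed A.
Proof.
move=> [d d0 h]; rewrite -openC open_dR => p nAp; exists d => // q pq Aq; apply: nAp.
by apply: h Aq; rewrite dRC.
Qed.

(** The function is locally constant, and its support is a closed set on which [Rvec] has constant
    length. *)
Lemma efun_Cc P t t' : is_patch D P -> P t -> P t' -> Cc (efun D P t t').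
Proof.
move=> hP Pt Pt'; have [d d0 near] := Vset_near HD hP Pt Pt'; split.
  apply: continuous_dR => p e e0; exists d => // q pq.
  have -> : efun D P t t' p = efun D P t t' q.
    rewrite /efun !indicE; congr (_%:R); congr nat_of_bool.
    apply/idP/idP => /set_mem h; apply/mem_set; first exact: near h.
    by apply: near h; rewrite dRC.
  by rewrite subrr normr0 ltcR.
have -> : [set p | efun D P t t' p != 0] = Vset P t t'.
  apply/seteqP; split => p /=; rewrite /efun indicE pnatr_eq0 eqb0 negbK; first by move/set_mem.
  by move/mem_set.
have cV : closed (Vset P t t' : set (Rpunc D)) by apply: near_closed; exists d.
rewrite -(closure_id _).1 //.
apply: (subclosed_compact cV (@Rvec_ball_compact _ _ HD (fnorm (punc D t' - punc D t)))).
move=> p /VsetP[a [_ tp]] /=.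
by rewrite (Rvec_unique HD tp) opprK fnorm_rot.
Qed.

Lemma zfun_Cc : Cc (zfun D).
Proof.
have [d d0 near] := diag_near HD.
have [M M0 out] := outer_radius HD.
have diag p q : dR p q < d -> (src p == tgt p) = (src q == tgt q).
  by move=> pq; apply/eqP/eqP; apply: near; rewrite // dRC.
split.
  apply: continuous_dR => p e e0.
  have [d' d'0 close] := dGamma_close HD M e0.
  exists (Num.min d d'); first by rewrite lt_min d0.
  move=> q; rewrite lt_min => /andP[/diag pq /dR_lt[pq' _]].
  rewrite /zfun -pq; case: ifPn => [pd|_]; last by rewrite subrr normr0 ltcR.
  have [a ae pat] := close _ _ (srcP p) (srcP q) pq'.
  have [T0 z0] := tile0P HD (srcP p).
  have ist := Omega_tile HD (srcP p).1 T0.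
  have z0' : punc D (mvset a 0 (tile0 (src p))) = 0.
    by rewrite (punc_move HD) // z0 rot_mx0 addr0.
  (* Agreement up to the small rotation [a] on a ball of radius [M] includes the tile at the origin,
     so the phase changes by the factor [expi a]. *)
  have -> : tile0 (src q) = mvset a 0 (tile0 (src p)).
    apply: (tile0E HD (srcP q).1) => //.
    suff : patch_in_ball (mvtil a 0 (src p)) 0 M (mvset a 0 (tile0 (src p))).
      by rewrite pat => -[].
    split; first exact: mvtil_in.
    by have := out _ (istile_move a 0 ist); rewrite z0'.
  rewrite (expi_rot (angle_move HD a 0 ist)) expiD -{1}[expi (tile_angle _ _)]mul1r -mulrBl.
  rewrite normrM norm_expi mulr1 distrC; apply: le_lt_trans (norm_expiB1 a) _.
  by rewrite ltcR.
have -> : [set p | zfun D p != 0] = [set p : Rpunc D | src p = tgt p].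
  apply/seteqP; split => p /=; last by move=> h; rewrite /zfun h eqxx expi_neq0.
  by move=> zp; apply: contrapT => h; move: zp; rewrite /zfun; case: (src p =P tgt p) => // _; rewrite eqxx.
have cV : closed [set p : Rpunc D | src p = tgt p] by apply: near_closed; exists d.
rewrite -(closure_id _).1 //.
apply: (subclosed_compact cV (@Rvec_ball_compact _ _ HD 0)) => p /= /(Rvec0 HD) ->.
by rewrite fnorm0.
Qed.

(** * Convolution with diagonal functions and powers of [zfun] *)

Lemma Rpunc_mk T1 T2 : Rpunc_set D (T1, T2) -> exists p : Rpunc D, src p = T1 /\ tgt p = T2.
Proof.
by move=> /mem_set h; exists (exist (fun z : tiles R * tiles R => z \in Rpunc_set D) _ h).
Qed.

Lemma RvalueE f p : Rvalue f (src p) (tgt p) = f p.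
Proof. by rewrite /Rvalue /src /tgt -surjective_pairing valK. Qed.

(** The sum over a class is meaningful when its support is finite; a single possibly nonzero term
    reduces it to that term. *)
Lemma convolution_term f g p T3 : Rclass D (src p) T3 ->
  (forall T, Rclass D (src p) T -> T <> T3 ->
     Rvalue f (src p) T * Rvalue g T (tgt p) = 0) ->
  convolution f g p = Rvalue f (src p) T3 * Rvalue g T3 (tgt p).
Proof.
move=> cT3 h; rewrite /convolution -(fsbig_widen [set T3]) ?fsbig_set1 //.
- by move=> _ ->.
- by move=> T [cT /= TT3]; exact: h.
Qed.

Lemma convolution_diagl f g p : (forall q, src q <> tgt q -> f q = 0) ->
  convolution f g p = Rvalue f (src p) (src p) * g p.
Proof.
move=> fd; rewrite (@convolution_term f g p (src p)) ?RvalueE //.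
  exact: (Rpunc_refl HD (srcP p)).
move=> T /Rpunc_mk[q [qs qt]] Tp; rewrite -qs -qt RvalueE fd ?mul0r //.
by rewrite qs qt => /esym.
Qed.

Lemma convolution_diagr f g p : (forall q, src q <> tgt q -> g q = 0) ->
  convolution f g p = f p * Rvalue g (tgt p) (tgt p).
Proof.
move=> gd; rewrite (@convolution_term f g p (tgt p)) ?RvalueE //.
  exact: Rpunc_in.
move=> T cT Tp.
have /Rpunc_mk[q [qs qt]] := Rpunc_trans HD (Rpunc_sym HD cT) (Rpunc_in p).
by rewrite -[in Rvalue g _ _]qs -qt RvalueE gd ?mulr0 // qs qt.
Qed.

Definition zangle T : R := tile_angle D (tile0 T).

Lemma Rvalue_zfun T : Omega_punc D T -> Rvalue (zfun D) T T = expi (zangle T).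
Proof.
move=> /(Rpunc_refl HD)/Rpunc_mk[q [qs qt]].
by rewrite -{2}qt -{1}qs RvalueE /zfun qs qt eqxx.
Qed.

Lemma zfun_diag q : src q <> tgt q -> zfun D q = 0.
Proof. by move=> h; rewrite /zfun; case: eqP. Qed.

Lemma involution_zfun_diag q : src q <> tgt q -> involution (zfun D) q = 0.
Proof.
move=> h; have /Rpunc_mk[q' [qs qt]] := Rpunc_sym HD (Rpunc_in q).
rewrite /involution -qs -qt RvalueE zfun_diag; last by rewrite qs qt => /esym.
exact: conjc0.
Qed.

Lemma Rvalue_involution_zfun T : Omega_punc D T ->
  Rvalue (involution (zfun D)) T T = expi (- zangle T).
Proof.
move=> OT; have := Rpunc_refl HD OT => /Rpunc_mk[q [qs qt]].
by rewrite -{2}qt -{1}qs RvalueE /involution qs qt Rvalue_zfun // expiN.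
Qed.

Lemma diag_funE p : @diag_fun R D p = if src p == tgt p then 1 else 0.
Proof.
rewrite /diag_fun indicE; case: eqP => h; first by rewrite mem_set.
by rewrite memNset.
Qed.

(** Diagonal functions convolve by multiplying their diagonal values, so phases add; the adjoint
    supplies the opposite phase for negative powers. *)
Lemma upow_zfun (k : int) p :
  upow (zfun D) k p = if src p == tgt p then expi (k%:~R * zangle (src p)) else 0.
Proof.
case: k => n; rewrite /upow.
  elim: n p => [|n IH] p /=; first by rewrite diag_funE mul0r expi0.
  rewrite convolution_diagl; last exact: zfun_diag.
  rewrite Rvalue_zfun ?IH; last exact: srcP.
  case: ifP; rewrite ?mulr0 // -expiD => _; congr expi.
  by rewrite -!pmulrn -natr1 mulrDl mul1r addrC.
have E : forall m p, iter m (convolution (involution (zfun D))) (@diag_fun R D) p =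
    if src p == tgt p then expi (- (m%:R * zangle (src p))) else 0.
  elim=> [|m IH] q /=; first by rewrite diag_funE mul0r oppr0 expi0.
  rewrite convolution_diagl; last exact: involution_zfun_diag.
  rewrite Rvalue_involution_zfun ?IH; last exact: srcP.
  case: ifP; rewrite ?mulr0 // -expiD => _; congr expi.
  by rewrite -natr1 mulrDl mul1r opprD addrC.
by rewrite E NegzE mulrNz mulNr -pmulrn.
Qed.

Lemma convolution_upow_zfun (k : int) f p :
  convolution (upow (zfun D) k) f p = expi (k%:~R * zangle (src p)) * f p.
Proof.
rewrite convolution_diagl; last by move=> q h; rewrite upow_zfun; case: eqP.
have := Rpunc_refl HD (srcP p) => /Rpunc_mk[q [qs qt]].
by rewrite -{2}qt -{1}qs RvalueE upow_zfun qs qt eqxx.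
Qed.

(** * Composition of the sets [Vset] and the identities *)

Lemma efunE P t t' p : efun D P t t' p = (`[< Vset P t t' p >])%:R.
Proof. by rewrite /efun indicE. Qed.

Lemma efun_in P t t' p : Vset P t t' p -> efun D P t t' p = 1.
Proof. by move=> h; rewrite efunE asboolT. Qed.

Lemma efun_notin P t t' p : ~ Vset P t t' p -> efun D P t t' p = 0.
Proof. by move=> h; rewrite efunE asboolF. Qed.

(** Change of base point: passing from source to target turns the copy of [P] with [t] at the origin
    into the copy with [t'] at the origin, by the same rotation. *)
Lemma shift_patch a t t' P :
  mvtil 0 (- (rot a *m (punc D t' - punc D t))) (mvtil a (- (rot a *m punc D t)) P) =
  mvtil a (- (rot a *m punc D t')) P.
Proof.
rewrite mvtil_comp add0r rot0m mulmxBr opprB addrA addNr add0r //.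
Qed.

Lemma Vset_swap P t t' p q : src q = tgt p -> tgt q = src p ->
  Vset P t t' p -> Vset P t' t q.
Proof.
move=> qs qt /VsetP[a [Pp tp]]; apply/VsetP; exists a; split.
  by rewrite qs tp -(shift_patch a t t'); exact: mvtil_sub.
by rewrite qs qt tp mvtil_comp rot0m !mulmxBr !opprB addr0 addrA subrK subrr mvtil0.
Qed.

(** The moved copy of [t] has puncture 0. Hence the tile at the origin reveals the rotation of the
    patch. *)
Lemma tile0_motion P t p a : is_patch D P -> P t ->
  mvtil a (- (rot a *m punc D t)) P `<=` src p ->
  tile0 (src p) = mvset a (- (rot a *m punc D t)) t.
Proof.
move=> hP Pt Pp; apply: (tile0E HD (srcP p).1); first by apply: Pp; exact: mvtil_in.
by rewrite (punc_move HD) ?addrN //; exact: (patch_tile HD hP).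
Qed.

Lemma zangle_motion P t p a : is_patch D P -> P t ->
  mvtil a (- (rot a *m punc D t)) P `<=` src p ->
  rot (zangle (src p)) = rot (a + tile_angle D t).
Proof.
move=> hP Pt Pp; rewrite /zangle (tile0_motion hP Pt Pp) (angle_move HD) //.
exact: (patch_tile HD hP).
Qed.

(** With [P] turned by [a], the tiles at the origin of source and target have the angles of [t] and
    [t'] increased by [a]; subtraction eliminates [a]. *)
Lemma Vset_zangle P t t' p : is_patch D P -> P t -> P t' -> Vset P t t' p ->
  rot (zangle (tgt p)) = rot (zangle (src p) + (tile_angle D t' - tile_angle D t)).
Proof.
move=> hP Pt Pt' Vp.
have /Rpunc_mk[q [qs qt]] := Rpunc_sym HD (Rpunc_in p).
move/VsetP: Vp => [a [Pp tp]].
have Pq : mvtil a (- (rot a *m punc D t')) P `<=` src q.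
  by rewrite qs tp -(shift_patch a t t'); exact: mvtil_sub.
rewrite -qs (zangle_motion hP Pt' Pq) (addrC (zangle _)).
rewrite (rot_eqD _ (zangle_motion hP Pt Pp)); congr rot; ring.
Qed.

(** In the middle tiling the tile at the origin is the copy of [t] under both motions, so rigidity
    makes the rotations of [P1] and [P2] equal; moved back to the source, the two copies form one
    copy of the union. *)
Lemma Vset_comp P1 P2 t1 t t2 p q1 q2 : is_patch D P1 -> is_patch D P2 ->
  P1 t1 -> P1 t -> P2 t ->
  src q1 = src p -> tgt q1 = src q2 -> tgt q2 = tgt p ->
  Vset P1 t1 t q1 -> Vset P2 t t2 q2 -> Vset (P1 `|` P2) t1 t2 p.
Proof.
move=> hP1 hP2 P1t1 P1t P2t s1 s12 t2p /VsetP[a [Pa ta]] /VsetP[b [Pb tb]].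
have ab : rot a = rot b.
  apply: (@tile_rigid _ _ HD _ _ (- (rot a *m punc D t)) (- (rot b *m punc D t)) _
    (patch_tile HD hP1 P1t)).
  rewrite -(tile0_motion hP2 P2t Pb); apply/esym/(tile0_motion hP1 P1t).
  by rewrite -s12 ta -(shift_patch a t1 t); exact: mvtil_sub.
have sq2 : src p = mvtil 0 (- (rot a *m (punc D t1 - punc D t))) (src q2).
  rewrite -s12 ta s1 mvtil_comp rot0m !mulmxBr !opprB addr0 addrA subrK subrr.
  by rewrite mvtil0.
apply/VsetP; exists a; split.
  rewrite -s1 /mvtil image_setU => u [|] h; first exact: Pa.
  rewrite s1 sq2; move: u h.
  rewrite -[[set _ | _ in _]]/(mvtil a (- (rot a *m punc D t1)) P2) -(shift_patch a t t1).
  by apply: mvtil_sub; rewrite (mvtil_rot _ _ ab) ab.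
rewrite -t2p tb -s12 ta s1 mvtil_comp rot0m -ab addr0 !mulmxBr !opprB.
by rewrite addrA subrK.
Qed.

(** The middle tiling is the source recentred at the copy of [t]; the rotation of the union serves
    both patches. *)
Lemma Vset_split P1 P2 t1 t t2 p : is_patch D P1 -> P1 t1 -> P1 t -> 
  Vset (P1 `|` P2) t1 t2 p ->
  exists q1 q2 : Rpunc D, [/\ src q1 = src p, tgt q1 = src q2, tgt q2 = tgt p,
    Vset P1 t1 t q1 & Vset P2 t t2 q2].
Proof.
move=> hP1 P1t1 P1t /VsetP[a [Pa ta]].
pose T3 := mvtil 0 (- (rot a *m (punc D t - punc D t1))) (src p).
have pT3 : Rpunc_set D (src p, T3).
  apply/Rpunc_setP; split; first exact: srcP.
  exists (mvset a (- (rot a *m punc D t1)) t).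
    by apply: Pa; apply: mvtil_in; left.
  by rewrite (punc_move HD) -?mulmxBr //; exact: (patch_tile HD hP1).
have /Rpunc_mk[q1 [s1 t1q]] := pT3.
have /Rpunc_mk[q2 [s2 t2q]] := Rpunc_trans HD (Rpunc_sym HD pT3) (Rpunc_in p).
exists q1, q2; split => //; first by rewrite t1q s2.
  apply/VsetP; exists a; rewrite s1 t1q; split => //.
  by apply: subset_trans Pa; apply: mvtil_sub => u; left.
apply/VsetP; exists a; rewrite s2 t2q; split.
  rewrite -(shift_patch a t1 t); apply: mvtil_sub.
  by apply: subset_trans Pa; apply: mvtil_sub => u; right.
rewrite ta /T3 mvtil_comp rot0m addr0 !mulmxBr !opprB.
by rewrite addrA subrK.
Qed.

Lemma Vset_tgt_unique P t t' p q : is_patch D P -> P t -> src p = src q ->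
  Vset P t t' p -> Vset P t t' q -> tgt p = tgt q.
Proof.
move=> hP Pt pq /VsetP[a [Pa ->]] /VsetP[b [Pb ->]]; rewrite -pq in Pb *.
suff -> : rot a = rot b by [].
apply: (@tile_rigid _ _ HD _ _ (- (rot a *m punc D t)) (- (rot b *m punc D t)) _
  (patch_tile HD hP Pt)).
by rewrite -(tile0_motion hP Pt Pa) -(tile0_motion hP Pt Pb).
Qed.

(** The weights stand for powers of [zfun]: a phase of the middle tiling is rewritten by [c] as one
    of the source, so it can leave the sum. Constant weights give the product of the [efun]
    alone. *)
Lemma convolution_efun P1 P2 t1 t t2 (c1 c2 c : tiles R -> R[i]) p :
  is_patch D P1 -> is_patch D P2 -> P1 t1 -> P1 t -> P2 t ->
  (forall q, Vset P1 t1 t q -> c2 (tgt q) = c (src q)) ->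
  convolution (fun q => c1 (src q) * efun D P1 t1 t q)
              (fun q => c2 (src q) * efun D P2 t t2 q) p =
  c1 (src p) * (c (src p) * efun D (P1 `|` P2) t1 t2 p).
Proof.
move=> hP1 hP2 P1t1 P1t P2t cE.
have [Vp|nVp] := pselect (Vset (P1 `|` P2) t1 t2 p).
  have [q1 [q2 [s1 s12 t2p V1 V2]]] := Vset_split hP1 P1t1 P1t Vp.
  rewrite (@convolution_term _ _ p (tgt q1)).
  - by rewrite -s1 RvalueE s12 -t2p RvalueE !efun_in // -s12 (cE _ V1) !mulr1.
  - by rewrite /Rclass -s1; exact: Rpunc_in.
  (* The source determines the rotation of [P1] and so the only middle tiling that contributes. *)
  move=> T /Rpunc_mk[q [qs qt]] Tq1; rewrite -qs -qt RvalueE (efun_notin (p := q)).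
    by rewrite mulr0 mul0r.
  move=> Vq; apply: Tq1; rewrite -qt; apply: (Vset_tgt_unique hP1 P1t1 _ Vq V1).
  by rewrite qs s1.
(* A nonzero term would compose to put [p] in the set of the union. *)
rewrite (efun_notin nVp) !mulr0 /convolution fsbig1 // => T pT.
have /Rpunc_mk[q1 [s1 t1q]] := pT.
have /Rpunc_mk[q2 [s2 t2q]] := Rpunc_trans HD (Rpunc_sym HD pT) (Rpunc_in p).
rewrite -{1}s1 -{1}t1q -s2 -t2q !RvalueE.
have [V1|/efun_notin ->] := pselect (Vset P1 t1 t q1); last by rewrite mulr0 mul0r.
have [V2|/efun_notin ->] := pselect (Vset P2 t t2 q2); last by rewrite !mulr0.
exfalso; apply: nVp; apply: (Vset_comp hP1 hP2 P1t1 P1t P2t s1 _ t2q V1 V2).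
by rewrite t1q s2.
Qed.

Lemma involution_efun P t t' : involution (efun D P t t') = efun D P t' t.
Proof.
apply/funext => p; rewrite /involution.
have /Rpunc_mk[q [qs qt]] := Rpunc_sym HD (Rpunc_in p).
rewrite -qs -qt RvalueE.
have [V|nV] := pselect (Vset P t t' q).
  rewrite !efun_in //; first exact: conjc1.
  exact: Vset_swap V.
rewrite !efun_notin //; first exact: conjc0.
by move=> V; apply: nV; exact: Vset_swap V.
Qed.

Lemma zfun_efun_commute P t t' : is_patch D P -> P t -> P t' ->
  convolution (zfun D) (efun D P t t') =
  expi (tile_angle D t - tile_angle D t') \*o convolution (efun D P t t') (zfun D).
Proof.
move=> hP Pt Pt'; apply/funext => p /=.
rewrite convolution_diagl; last exact: zfun_diag.
rewrite convolution_diagr; last exact: zfun_diag.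
rewrite !Rvalue_zfun; [|exact: tgtP|exact: srcP].
have [V|/efun_notin ->] := pselect (Vset P t t' p); last by rewrite mul0r !mulr0.
rewrite efun_in // mul1r mulr1 (expi_rot (Vset_zangle hP Pt Pt' V)) -expiD.
congr expi; ring.
Qed.


Lemma convolution_efun_union P1 P2 t1 t t2 : is_patch D P1 -> is_patch D P2 ->
  P1 t1 -> P1 t -> P2 t ->
  convolution (efun D P1 t1 t) (efun D P2 t t2) = efun D (P1 `|` P2) t1 t2.
Proof.
move=> hP1 hP2 P1t1 P1t P2t; apply/funext => p.
have one P s s' : efun D P s s' = fun q => (fun=> 1) (src q) * efun D P s s' q.
  by apply/funext => q; rewrite mul1r.
rewrite (one P1) (one P2).
have -> := @convolution_efun P1 P2 t1 t t2 (fun=> 1) (fun=> 1) (fun=> 1) p hP1 hP2 P1t1 P1t P2t.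
  by rewrite !mul1r.
by [].
Qed.

Lemma convolution_zfun_efun_union P1 P2 t1 t t2 (k l : int) :
  is_patch D P1 -> is_patch D P2 -> P1 t1 -> P1 t -> P2 t ->
  convolution (convolution (upow (zfun D) k) (efun D P1 t1 t))
              (convolution (upow (zfun D) l) (efun D P2 t t2)) =
  expi (l%:~R * (tile_angle D t - tile_angle D t1))
    \*o convolution (upow (zfun D) (k + l)) (efun D (P1 `|` P2) t1 t2).
Proof.
move=> hP1 hP2 P1t1 P1t P2t; apply/funext => p /=.
have zE m P s s' : convolution (upow (zfun D) m) (efun D P s s') =
    fun q => (fun T => expi (m%:~R * zangle T)) (src q) * efun D P s s' q.
  by apply/funext => q; exact: convolution_upow_zfun.
rewrite !zE.
(* The angle at the middle tiling is that of the source plus the difference of the angles of [t] and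
   [t1]; this difference yields the scalar factor. *)
have -> := @convolution_efun P1 P2 t1 t t2 (fun T => expi (k%:~R * zangle T))
  (fun T => expi (l%:~R * zangle T))
  (fun T => expi (l%:~R * (zangle T + (tile_angle D t - tile_angle D t1))))
  p hP1 hP2 P1t1 P1t P2t.
  rewrite !mulrA -!expiD; congr (expi _ * _).
  rewrite intrD; ring.
by move=> q V; apply: expi_mulz; exact: Vset_zangle V.
Qed.

End Algebra.

Theorem lemma3p2 (R : realType) (D : tiling_data R) (HD : standing D) :
  [/\ Cc (zfun D),
      (forall (P : tiles R) (t t' : set (plane R)),
         is_patch D P -> P t -> P t' ->
         [/\ Cc (efun D P t t'),
             involution (efun D P t t') = efun D P t' t &
             convolution (zfun D) (efun D P t t') =
               expi (tile_angle D t - tile_angle D t')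
                 \*o convolution (efun D P t t') (zfun D)]) &
      (forall (P1 P2 : tiles R) (t1 t1' t2 t2' : set (plane R)),
         is_patch D P1 -> is_patch D P2 ->
         P1 t1 -> P1 t1' -> P2 t2 -> P2 t2' -> t1' = t2 -> agree P1 P2 ->
         convolution (efun D P1 t1 t1') (efun D P2 t2 t2') =
           efun D (P1 `|` P2) t1 t2' /\
         forall k l : int,
           convolution (convolution (upow (zfun D) k) (efun D P1 t1 t1'))
                       (convolution (upow (zfun D) l) (efun D P2 t2 t2')) =
             expi (l%:~R * (tile_angle D t2 - tile_angle D t1))
               \*o convolution (upow (zfun D) (k + l))
                               (efun D (P1 `|` P2) t1 t2'))].
Proof.
split; first exact: zfun_Cc.
- move=> P t t' hP Pt Pt'; split.
  + exact: efun_Cc.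
  + exact: involution_efun.
  + exact: zfun_efun_commute.
- move=> P1 P2 t1 t1' t2 t2' hP1 hP2 P1t1 P1t1' P2t2 _ t12 _; subst t2.
  split; first exact: convolution_efun_union.
  by move=> k l; exact: convolution_zfun_efun_union.
Qed.
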